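(* There exists a constant $C$ such that for all integers $k\ge5$ and $p\ge2$, \[ g(K_k,p)<\bigl(4\log_2 k+2\log_2\log_2 k+C\bigr)(p-1). \] Moreover, there exist a constant $c\in\mathbb R$ and an infinite set $K\subseteq\mathbb N$ such that for every $k\in K$ and every integer $p\ge2$, \[ g(K_k,p)\ge\Bigl(\tfrac83\log_2 k+c\Bigr)(p-1). \]
   Context: Graphs are finite and simple; the girth is the length of a shortest cycle. $g(K_k,p)$ is defined as $\sup\{g:\text{there is a }K_k\text{-minor-free graph }G\text{ with }\mathrm{girth}(G)\ge g\text{ that is not }p\text{-path degenerate}\}$. A strict ear of a graph $G$ is a path of $G$ whose internal vertices all have degree $2$ in $G$ and whose two endpoints are distinct. For an integer $p\ge1$, a $p$-reduction of $G$ is the deletion of either an isolated vertex, or a vertex of degree $1$, or the internal vertices of a strict ear of $G$ of length at least $p$. A graph is $p$-path degenerate if it can be reduced to the empty graph by a sequence of $p$-reductions. *)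

(* Defs.v *)
From HB Require Import structures.
From mathcomp Require Import all_boot all_order all_algebra.
From mathcomp Require Import all_classical all_reals all_analysis.
Set Implicit Arguments. Unset Strict Implicit. Unset Printing Implicit Defensive.
Import Order.TTheory GRing.Theory Num.Theory.

Section Graphs.
Variable T : finType.
Variable e : rel T.

Definition simple_graph : Prop := symmetric e /\ irreflexive e.

Definition induced (S : {set T}) : rel T :=
  fun x y => [&& x \in S, y \in S & e x y].

Definition connected_in (A : {set T}) : Prop :=
  forall x y, x \in A -> y \in A -> fingraph.connect (induced A) x y.

Definition has_K_minor (k : nat) : Prop :=
  exists B : 'I_k -> {set T},
    [/\ forall i, B i != finset.set0,
        forall i j, i != j -> [disjoint B i & B j],
        forall i, connected_in (B i) &
        forall i j, i != j -> exists x y, [/\ x \in B i, y \in B j & e x y]].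

Definition K_minor_free (k : nat) : Prop := ~ has_K_minor k.

(* girth(G) >= g : every cycle of G has length >= g (forests: girth = oo) *)
Definition girth_ge (g : nat) : Prop :=
  forall s : seq T, uniq s -> 3 <= size s -> path.cycle e s -> g <= size s.

Definition deg_in (S : {set T}) (x : T) : nat := #|[set y in S | e x y]|.

(* One p-reduction of the induced subgraph G[S], yielding G[S'].
   A strict ear is the path x :: mid ++ [y] (distinct vertices) of G[S],
   with x <> y, of length size mid + 1, whose internal vertices (mid) all
   have degree 2 in G[S]. *)
Inductive p_reduction (p : nat) (S : {set T}) : {set T} -> Prop :=
  | red_isolated x : x \in S -> deg_in S x = 0 -> p_reduction p S (S :\ x)
  | red_leaf x : x \in S -> deg_in S x = 1 -> p_reduction p S (S :\ x)
  | red_ear x (mid : seq T) y :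
      path.path (induced S) x (rcons mid y) ->
      uniq (x :: rcons mid y) -> x != y ->
      all (fun z => deg_in S z == 2) mid ->
      p <= (size mid).+1 ->
      p_reduction p S (S :\: [set z in mid]).

Inductive p_reducible (p : nat) : {set T} -> Prop :=
  | reducible_empty : p_reducible p finset.set0
  | reducible_step S S' : p_reduction p S S' -> p_reducible p S' ->
      p_reducible p S.

Definition p_path_degenerate (p : nat) : Prop := p_reducible p (finset.setT : {set T}).

End Graphs.

Definition gset (k p : nat) (g : nat) : Prop :=
  exists (T : finType) (e : rel T),
    [/\ simple_graph e, K_minor_free e k, girth_ge e g &
        ~ p_path_degenerate e p].

Local Open Scope ring_scope.
Local Open Scope classical_set_scope.

Definition gK (R : realType) (k p : nat) : \bar R :=
  ereal_sup [set ((g%:R : R)%:E) | g in [set g | gset k p g]].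

Definition log2 (R : realType) (x : R) : R := ln x / ln 2.

(* Main.v *)
(* Upper bound. A graph that is not p-path degenerate contains an induced subgraph of minimum degree at
   least 2 whose strict ears are shorter than p; suppressing its vertices of degree 2 yields a minor of
   minimum degree at least 3 and girth at least g / (p - 1). If this girth exceeds 4 r + 2, take a set X
   with O(n / 2^r) elements whose balls of radius r meet all but a small proportion of the edges and contract
   a breadth-first forest of depth r rooted at X: short cycles being absent, the remaining edges join distinct
   pairs of trees, so the contracted graph has average degree of order 2^r. By the theorem of Kostochka and
   Thomason (proved along the lines of Alon, Krivelevich and Sudakov) it has a K_k minor as soon as 2^r
   exceeds a constant times k sqrt(log k).

   Lower bound. Over the field with 2^D elements, right multiplication by the normalised quaternions
   1 + w j, w in {1, omega, omega^2}, defines three involutions of the set of quaternions of norm one, hence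
   a cubic bipartite graph on at most 2^(3 D + 2) vertices. A closed non-backtracking walk lifts to a product
   of the 1 + w j over F_2[X] that is congruent to a scalar modulo a polynomial g of degree at least D; since
   2 = 0, the norm equation improves this congruence to one modulo g^2, which forces length at least 4 D.
   Subdividing every edge into a path of length p - 1 multiplies the girth by p - 1, and a graph of maximum
   degree 3 with fewer than k (k - 3) vertices of degree 3 has no K_k minor. *)
Require Import Defs.
From HB Require Import structures.
From mathcomp Require Import all_boot zify.
Set Implicit Arguments. Unset Strict Implicit. Unset Printing Implicit Defensive.

(** * Non-backtracking walks and minors *)

Section NonBacktracking.
Variables (T : finType) (e : rel T).
Hypotheses (esym : symmetric e) (eirr : irreflexive e).

Fixpoint nbwalk (s : seq T) : bool :=
  if s is x :: s1 then
    if s1 is y :: s2 then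
      [&& e x y, (if s2 is z :: _ then x != z else true) & nbwalk s1]
    else true
  else true.

(** Backtracking concerns three consecutive vertices, so gluing walks requires an overlap in a whole
    edge, not just in a vertex. *)
Lemma nbwalk_join s a b t :
  nbwalk (s ++ [:: a; b]) -> nbwalk (a :: b :: t) -> nbwalk (s ++ a :: b :: t).
Proof.
elim: s => [|x [|y [|z s]] IH] //.
- by move=> /and3P[exa nxb _] h; apply/and3P; split.
- by move=> /and3P[exa nxb h1] h; apply/and3P; split=> //; exact: IH.
- by move=> /and3P[exa nxb h1] h; apply/and3P; split=> //; exact: IH.
Qed.

Lemma nbwalk_catr s t : nbwalk (s ++ t) -> nbwalk t.
Proof.
elim: s => //= x s IH; case E: (s ++ t) => [|y u]; last first.
  by case/and3P=> _ _; rewrite -E; exact: IH.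
by move: E; case: s {IH} => //= ->.
Qed.

Lemma nbwalk_rev s : nbwalk s -> nbwalk (rev s).
Proof.
elim: s => [|x [|y [|z s]] IH] // /and3P[exy h1 h2].
  by rewrite /= /rev /= esym exy.
rewrite -cat1s rev_cat -[y :: _]cat1s rev_cat -catA /=.
rewrite -[z :: s]cat1s rev_cat -catA; apply: nbwalk_join.
  by move: (IH h2); rewrite -[y :: _]cat1s rev_cat -[z :: s]cat1s rev_cat -catA.
rewrite /= (esym y x) exy; case/and3P: h2 => eyz _ _.
by rewrite esym eyz eq_sym h1.
Qed.

Lemma nbwalk_path x s : nbwalk (x :: s) -> path.path e x s.
Proof. by elim: s x => //= y s IH x /and3P[-> _ /IH]. Qed.

(** The tail is simple by induction, so only the first vertex can recur. The stretch up to its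
    recurrence is a cycle with fewer than [g] vertices; it has at least three, since there are
    neither loops nor backtracking. *)
Lemma nbwalk_uniq g s :
  girth_ge e g -> nbwalk s -> size s <= g -> uniq s.
Proof.
move=> gth; elim: s => //= x t IH nb szg.
have ut : uniq t.
  apply: IH; last by lia.
  by apply: (@nbwalk_catr [:: x]).
rewrite ut andbT; apply/negP => /path.splitPr E.
case: E nb szg ut => t1 t2 nb szg; rewrite cat_uniq => /and3P[u1 /hasPn/(_ x) hx _].
have xt1 : x \notin t1 by apply: hx; rewrite mem_head.
have cyc : path.cycle e (x :: t1).
  have := nbwalk_path nb; rewrite path.cat_path /= => /and3P[p1 l1 _].
  by rewrite path.rcons_path p1.
have sz : 3 <= size (x :: t1).
  case: (t1) nb => [|y [|]] //=.
    by rewrite eirr.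
  by rewrite eqxx andbF.
have := gth (x :: t1) _ sz cyc; rewrite /= xt1 u1 => /(_ isT).
by move: szg; rewrite size_cat /=; lia.
Qed.

(* Strip the common prefix; the rest is a closed non-backtracking walk. *)
Lemma nbwalk_unique g x P Q :
  girth_ge e g -> nbwalk (x :: P) -> nbwalk (x :: Q) -> last x P = last x Q ->
  size P + size Q < g -> P = Q.
Proof.
move=> gth; elim: P x Q => [|p P IH] x [|q Q] // nP nQ.
- move=> /= El sz; have := nbwalk_uniq gth nQ sz.
  by rewrite /= El mem_last.
- move=> /= El; rewrite addn0 => sz; have := nbwalk_uniq gth nP sz.
  by rewrite /= -El mem_last.
have [Epq|npq] := eqVneq p q; first subst q.
  move=> /= El sz; congr cons.
  apply: (IH p) => //; last by lia.
  - exact: (@nbwalk_catr [:: x]).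
  - exact: (@nbwalk_catr [:: x]).
move=> El sz.
have nW : nbwalk (rev P ++ p :: x :: q :: Q).
  apply: nbwalk_join.
    have := nbwalk_rev nP.
    by rewrite -cat1s rev_cat -[p :: P]cat1s rev_cat -catA.
  case/and3P: nP => exp _ _.
  by rewrite /= npq esym exp.
have := nbwalk_uniq gth nW; rewrite size_cat size_rev /=.
move=> /(_ ltac:(by move: sz; rewrite /=; lia)).
rewrite -[p :: x :: _]/([:: p; x] ++ q :: Q) catA cat_uniq => /and3P[_ /hasPn h _].
have /h : last x (q :: Q) \in q :: Q by rewrite /= mem_last.
rewrite -El mem_cat mem_rev /=.
by have := mem_last p P; rewrite !inE => /orP[->|->] //; rewrite ?orbT.
Qed.

End NonBacktracking.

(** Minors are lifted along maps whose fibre over an isolated vertex may be empty. For [1 < k],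
    adjacency to a second branch set provides a nonempty fibre. *)
Definition complete_minor_le (T' T : finType) (e' : rel T') (e : rel T) : Prop :=
  forall k, 1 < k -> has_K_minor e' k -> has_K_minor e k.

Lemma connect_path_ind (T : finType) (e : rel T) (P : T -> Prop) x y :
  fingraph.connect e x y -> P x -> (forall u v, P u -> e u v -> P v) -> P y.
Proof.
move=> /fingraph.connectP[s ps ->] + step.
elim: s x ps => //= z s IH x /andP[exz ps] Px.
by apply: IH ps (step _ _ Px exz).
Qed.

Lemma connect_sub_rel (T : finType) (e e' : rel T) x y :
  (forall u v, e u v -> e' u v) -> fingraph.connect e x y -> fingraph.connect e' x y.
Proof. by move=> h; apply: fingraph.connect_sub => u v /h/fingraph.connect1. Qed.

Lemma minor_fibres (T T' : finType) (e : rel T) (e' : rel T') (f : T -> option T') :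
  (forall x u v, f u = Some x -> f v = Some x ->
     fingraph.connect (induced e [set w | f w == Some x]) u v) ->
  (forall x y, e' x y -> exists u v, [/\ f u = Some x, f v = Some y & e u v]) ->
  complete_minor_le e' e.
Proof.
move=> fib adj k k1 [B [Bn0 Bd Bc Be]].
pose B' i := [set u | if f u is Some x then x \in B i else false].
exists B'; split.
- move=> i; have [j ij] : exists j : 'I_k, i != j.
    case: (eqVneq (val i) 0) => [i0|i0].
      by exists (Ordinal k1); apply/eqP => /(congr1 (@nat_of_ord _)) /= E; move: i0 => /=; rewrite E.
    by exists (Ordinal (ltnW k1)); apply/eqP => /(congr1 (@nat_of_ord _)) /= E; move: i0 => /=; rewrite E.
  have [x [y [xi _ /adj[u [v [fu _ _]]]]]] := Be i j ij.
  by apply/set0Pn; exists u; rewrite inE fu.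
- move=> i j /Bd dij; rewrite disjoint_subset; apply/subsetP => u.
  rewrite !inE; case: (f u) => // x xi.
  by move: (disjointFr dij xi) => ->.
- move=> i u v; rewrite !inE; case fu: (f u) => [x|] //; case fv: (f v) => [y|] // xi yi.
  have fib' x' u' v' : x' \in B i -> f u' = Some x' -> f v' = Some x' ->
      fingraph.connect (induced e (B' i)) u' v'.
    move=> x'i fu' fv'; apply: connect_sub_rel (fib _ _ _ fu' fv') => a b.
    by rewrite /induced !inE => /and3P[/eqP-> /eqP-> ->]; rewrite x'i.
  have := connect_path_ind (P := fun y => y \in B i /\ forall v, f v = Some y ->
     fingraph.connect (induced e (B' i)) u v) (Bc i x y xi yi).
  case => //.
  + by split => // v' fv'; exact: (fib' x).
  + move=> a b [ai IH] /and3P[_ bi /adj[a' [b' [fa' fb' eab]]]]; split=> // v' fv'.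
    apply: fingraph.connect_trans (IH _ fa') _.
    apply: (@fingraph.connect_trans _ _ b'); last by apply: (fib' b).
    apply: fingraph.connect1; rewrite /induced !inE fa' fb' ai bi eab.
    by [].
  + by move=> _; apply.
- move=> i j /Be[x [y [xi yj /adj[u [v [fu fv euv]]]]]].
  by exists u, v; split=> //; rewrite inE ?fu ?fv.
Qed.

Lemma minor_subrel (T : finType) (e e' : rel T) :
  (forall x y, e' x y -> e x y) -> complete_minor_le e' e.
Proof.
move=> h; apply: (@minor_fibres _ _ _ _ (@Some T)).
  by move=> x u v [->] [->].
by move=> x y /h exy; exists x, y.
Qed.

Lemma minor_trans (T1 T2 T3 : finType) (e1 : rel T1) (e2 : rel T2) (e3 : rel T3) :
  complete_minor_le e1 e2 -> complete_minor_le e2 e3 -> complete_minor_le e1 e3.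
Proof. by move=> h1 h2 k k1 /(h1 k k1)/(h2 k k1). Qed.

Section Degree.
Variables (T : finType) (e : rel T).

Definition nbh (x : T) : {set T} := [set y | e x y].
Definition deg (x : T) : nat := #|nbh x|.

(* [v] is merged into [u] and becomes isolated. *)
Definition contract (u v : T) : rel T := fun x y =>
  [&& x != v, y != v, x != y &
      [|| e x y, (x == u) && e v y | (y == u) && e x v]].

Lemma contract_sym u v : symmetric e -> symmetric (contract u v).
Proof.
move=> s x y; rewrite /contract (s x y) (s v y) (s v x) [x == y]eq_sym.
by rewrite andbCA; do 3 congr (_ && _); congr (_ || _); rewrite orbC.
Qed.

Lemma contract_irr u v : irreflexive (contract u v).
Proof. by move=> x; rewrite /contract eqxx !andbF. Qed.

Lemma minor_contract u v : symmetric e -> e u v -> u != v ->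
  complete_minor_le (contract u v) e.
Proof.
move=> s euv nuv; apply: (@minor_fibres _ _ _ _ (fun w => Some (if w == v then u else w))).
  move=> x a b [Ea] [Eb].
  have [->|nab] := eqVneq a b; first by [].
  apply: fingraph.connect1; rewrite /induced !inE Ea Eb eqxx /=.
  move: Ea Eb nab; case: eqP => [->|_]; case: eqP => [->|_]; rewrite ?eqxx //.
  - by move=> <- -> _; rewrite s.
  - by move=> -> <-.
  - by move=> -> ->; rewrite eqxx.
move=> x y /and4P[xv yv xy /or3P[exy|/andP[/eqP-> evy]|/andP[/eqP-> exv]]].
- by exists x, y; rewrite (negPf xv) (negPf yv).
- by exists v, y; rewrite eqxx (negPf yv).
- by exists x, v; rewrite eqxx (negPf xv).
Qed.

End Degree.

(** * Suppression of vertices of degree two *)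

Section Weight.
Variables (T : finType).

Fixpoint wt (l : T -> T -> nat) (x : T) (s : seq T) : nat :=
  if s is y :: s' then l x y + wt l y s' else 0.

End Weight.

Section Suppress.
Variables (T : finType) (e : rel T) (l : T -> T -> nat).
Hypotheses (esym : symmetric e) (eirr : irreflexive e).
Variables a b z : T.
Hypothesis Nz : nbh e z = [set a; b].
Hypothesis nab : a != b.
Hypothesis eab : ~~ e a b.
Let e' := contract e a z.

Definition joins x y := (x == a) && (y == b) || (x == b) && (y == a).
(** The new edge inherits the length of the path it replaces, so weights count original edges. *)
Definition suppress_weight x y := if joins x y then l x z + l z y else l x y.
Let l' := suppress_weight.

Let ez y : e z y = (y == a) || (y == b).
Proof. by have := in_set2 y a b; rewrite -Nz inE. Qed.
Let eza : e z a. Proof. by rewrite ez eqxx. Qed.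
Let ezb : e z b. Proof. by rewrite ez eqxx orbT. Qed.
Let az : a != z. Proof. by apply: contraTneq eza => ->; rewrite eirr. Qed.
Let bz : b != z. Proof. by apply: contraTneq ezb => ->; rewrite eirr. Qed.

Lemma suppressE x y : e' x y = [&& x != z, y != z & joins x y || e x y].
Proof.
rewrite /e' /contract /joins (esym x z) !ez.
have [->|xz] //= := eqVneq x z; have [->|yz] //= := eqVneq y z.
have [->|xy] /= := eqVneq x y.
  rewrite eirr orbF; symmetry; apply/negbTE.
  by apply/negP => /orP[] /andP[/eqP-> /eqP E]; move: nab; rewrite E eqxx.
rewrite orbC; congr (_ || _).
have [Exa|xa] /= := eqVneq x a; have [Eya|ya] /= := eqVneq y a;
  rewrite ?andbF ?orbF ?andbT //.
by rewrite Exa Eya eqxx in xy.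
Qed.

Lemma joins_sym x y : joins x y = joins y x.
Proof. by rewrite /joins orbC [(y == a) && _]andbC [(y == b) && _]andbC. Qed.

Let degz : deg e z = 2.
Proof. by rewrite /deg Nz cards2 nab. Qed.

Let deg'_end c d : c != d -> ~~ e c d -> e c z -> d != z ->
  (forall y, joins c y = (y == d)) -> deg e' c = deg e c.
Proof.
move=> ncd ecd ecz dz jc.
have cz : c != z by apply: contraTneq ecz => ->; rewrite eirr.
have -> : deg e' c = #|d |: (nbh e c :\ z)|.
  apply: eq_card => y; rewrite !inE suppressE cz jc /=.
  by have [->|yd] /= := eqVneq y d; rewrite ?dz ?andbT.
by rewrite cardsU1 /deg !inE (negPf ecd) andbF (cardsD1 z (nbh e c)) inE ecz.
Qed.

Lemma suppress_deg x : x != z -> deg e' x = deg e x.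
Proof.
move=> xz; have [->|xa] := eqVneq x a.
  apply: (deg'_end (d := b)) => //; first by rewrite esym.
  by move=> y; rewrite /joins eqxx (negPf nab) orbF.
have [->|xb] := eqVneq x b.
  apply: (deg'_end (d := a)) => //; rewrite 1?esym // 1?eq_sym //.
  by move=> y; rewrite /joins eqxx eq_sym (negPf nab).
apply: eq_card => y; rewrite !inE suppressE xz /joins (negPf xa) (negPf xb) /=.
have [->|] //= := eqVneq y z.
by rewrite esym ez (negPf xa) (negPf xb).
Qed.

Lemma suppress_deg0 : deg e' z = 0.
Proof. by apply: eq_card0 => y; rewrite !inE suppressE eqxx. Qed.

Fixpoint unsuppress (x : T) (s : seq T) : seq T :=
  if s is y :: s' then
    if joins x y then [:: z, y & unsuppress y s'] else y :: unsuppress y s'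
  else [::].

Lemma last_unsuppress x s : last x (unsuppress x s) = last x s.
Proof. by elim: s x => //= y s IH x; case: ifP => _ /=; rewrite IH. Qed.

Let joinsE x y : joins x y -> e x z && e z y.
Proof. by rewrite esym !ez => /orP[] /andP[-> ->]; rewrite ?orbT. Qed.

Lemma path_unsuppress x s : path.path e' x s -> path.path e x (unsuppress x s).
Proof.
elim: s x => //= y s IH x /andP[]; rewrite suppressE => /and3P[xz yz exy] /IH {}IH.
case: ifP => [/joinsE/andP[e1 e2]|j]; rewrite /= IH ?e1 ?e2 //.
by move: exy; rewrite j /= => ->.
Qed.

Lemma path_suppress_notin x s : path.path e' x s -> z \notin s.
Proof.
elim: s x => //= y s IH x /andP[]; rewrite suppressE => /and3P[_ yz _] /IH.
by rewrite inE eq_sym (negPf yz).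
Qed.

Lemma wt_unsuppress x s : wt l' x s = wt l x (unsuppress x s).
Proof.
elim: s x => //= y s IH x; rewrite IH /l' /suppress_weight; case: ifP => //= _.
by rewrite addnA.
Qed.

Lemma unsuppress_id x y s : (x == a) || (x == b) -> x != y -> x \notin s ->
  unsuppress y s = s.
Proof.
move=> xab; elim: s y => //= w s IH y xy; rewrite inE => /norP[xw xs].
rewrite IH //; case: ifP => // j; exfalso.
by case/orP: xab xy xw j => /eqP-> ay aw; rewrite /joins ![_ == a]eq_sym ![_ == b]eq_sym
  (negPf ay) (negPf aw) andbF.
Qed.

Lemma mem_unsuppress x s y : y \in unsuppress x s -> (y == z) || (y \in s).
Proof.
elim: s x => //= w s IH x; case: ifP => _; rewrite !inE.
  by case/or3P => [->|->|/IH/orP[]->]; rewrite ?orbT.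
by case/orP => [->|/IH/orP[]->]; rewrite ?orbT.
Qed.

Lemma uniq_unsuppress x s : z \notin x :: s -> uniq (x :: s) ->
  uniq (x :: unsuppress x s).
Proof.
elim: s x => // y s IH x zn /andP[xn u].
have zys : z \notin y :: s by move: zn; rewrite inE => /norP[].
have xz : x != z by move: zn; rewrite inE eq_sym => /norP[].
have xy : x != y by move: xn; rewrite inE => /norP[].
have xs : x \notin s by move: xn; rewrite inE => /norP[].
rewrite /=; case: ifP => j.
  rewrite (@unsuppress_id x) //; last by move: j => /orP[] /andP[-> _]; rewrite ?orbT.
  by rewrite /= !inE (negPf xz) (negPf xy) (negPf xs) /= -/(z \in y :: s) -in_cons zys.
have := IH y zys u; rewrite /= => ->; rewrite inE (negPf xy) andbT /=.
by apply/negP => /mem_unsuppress; rewrite (negPf xz) (negPf xs).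
Qed.

Lemma unsuppress_rcons x s y : exists s',
  unsuppress x (rcons s y) = rcons s' y /\ {subset s' <= z :: s}.
Proof.
elim: s x => [|w s IH] x /=.
  by case: ifP => _; [exists [:: z] | exists [::]]; split.
have [s' [-> h]] := IH w.
case: ifP => _; [exists [:: z, w & s'] | exists (w :: s')]; split => // t.
  by rewrite !inE => /or3P[->|->|/h]; rewrite ?orbT // inE => /orP[->|->]; rewrite ?orbT.
by rewrite !inE => /orP[->|/h]; rewrite ?orbT // inE => /orP[->|->]; rewrite ?orbT.
Qed.

Hypothesis lsym : forall x y, l x y = l y x.

Lemma suppress_weight_sym x y : l' x y = l' y x.
Proof.
by rewrite /l' /suppress_weight joins_sym (lsym y x) (lsym x z) (lsym z y) addnC.
Qed.

(** A cycle lifts to a cycle of the same weight by detours through [z]. The closing edge is not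
    recorded in the list: if it is the new edge, [z] is put in front of the lifted cycle. *)
Lemma suppress_girth g :
  (forall x s, uniq (x :: s) -> 2 <= size s -> path.path e x s -> e (last x s) x ->
     g <= wt l x s + l (last x s) x) ->
  forall x s, uniq (x :: s) -> 2 <= size s -> path.path e' x s -> e' (last x s) x ->
     g <= wt l' x s + l' (last x s) x.
Proof.
move=> G x s u sz p el.
have zs : z \notin x :: s.
  rewrite inE negb_or (path_suppress_notin p) andbT.
  by rewrite eq_sym; move: el; rewrite suppressE => /and3P[].
have [j|j] := boolP (joins (last x s) x); last first.
  have := G x (unsuppress x s) (uniq_unsuppress zs u) _ (path_unsuppress p).
  rewrite last_unsuppress wt_unsuppress /l' /suppress_weight (negPf j); apply.
    case: (s) sz => [|y [|w t]] //= _; case: ifP => _ //=; case: ifP => _ //=.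
  by move: el; rewrite suppressE (negPf j) => /and3P[].
(* The closing edge is already the new edge and the cycle has at least three vertices, so no other
   step uses the new edge. *)
have us : unsuppress x s = s.
  case: (s) u j sz => //= y t /and3P[xn yt _] j sz.
  have xy : x != y by move: xn; rewrite inE => /norP[].
  have xt : x \notin t by move: xn; rewrite inE => /norP[].
  have nj : joins x y = false.
    apply/negP => j2; move: yt.
    have -> : y = last y t.
      move: j j2 => /orP[] /andP[/eqP-> /eqP->]; rewrite /joins eqxx.
        by rewrite [b == a]eq_sym (negPf nab) /= => /eqP.
      by rewrite (negPf nab) orbF => /eqP.
    by case: (t) sz => //= w t' _; rewrite mem_last.
  rewrite nj (@unsuppress_id x) //.
  by move: j => /orP[] /andP[_ ->]; rewrite ?orbT.
have pe := path_unsuppress p; rewrite us in pe.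
have := G z (x :: s); rewrite [last _ _]/= [wt _ _ _]/=.
have /andP[e1 e2] := joinsE j.
rewrite wt_unsuppress us /l' /suppress_weight j => /(_ _ _ _ e1) h.
apply: leq_trans (h _ _ _) _.
- by rewrite cons_uniq zs u.
- exact: leqW.
- by rewrite /= e2 pe.
by rewrite /= -[leqLHS]addnA [leqLHS]addnC -[leqLHS]addnA.
Qed.

Lemma suppress_ear p :
  (forall x s y, path.path e x (rcons s y) -> uniq (x :: rcons s y) ->
     all (fun w => deg e w == 2) s -> wt l x (rcons s y) < p) ->
  forall x s y, path.path e' x (rcons s y) -> uniq (x :: rcons s y) ->
     all (fun w => deg e' w == 2) s -> wt l' x (rcons s y) < p.
Proof.
move=> E x s y p' u al.
have zs : z \notin x :: rcons s y.
  rewrite inE negb_or (path_suppress_notin p') andbT.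
  by case: (s) p' => [|w t] /=; rewrite suppressE eq_sym => /andP[/and3P[]].
rewrite wt_unsuppress; have [s' [Es hs]] := unsuppress_rcons x s y.
rewrite Es; apply: E; rewrite -?Es.
- exact: path_unsuppress.
- exact: uniq_unsuppress.
apply/allP => w /hs; rewrite inE => /predU1P[->|ws]; first by rewrite degz.
rewrite -suppress_deg; first by have /allP := al; apply.
by apply: contraNneq zs => <-; rewrite inE mem_rcons inE ws !orbT.
Qed.

End Suppress.

(** Induction on the number of vertices of degree two. Once there are none, each edge is an ear
    without internal vertices, hence of weight at most [p.-1], and the weighted girth bound becomes
    a bound on the number of edges. *)
Lemma suppress_all (T : finType) (e : rel T) (l : T -> T -> nat) (p g : nat) :
  symmetric e -> irreflexive e -> (forall x y, l x y = l y x) ->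
  (forall x, deg e x != 1) -> (exists x y, e x y) -> 3 * p.-1 < g ->
  (forall x s, uniq (x :: s) -> 2 <= size s -> path.path e x s -> e (last x s) x ->
     g <= wt l x s + l (last x s) x) ->
  (forall x s y, path.path e x (rcons s y) -> uniq (x :: rcons s y) ->
     all (fun w => deg e w == 2) s -> wt l x (rcons s y) < p) ->
  exists e' : rel T, [/\ symmetric e', irreflexive e', complete_minor_le e' e,
    (exists x y, e' x y) &
    (forall x, deg e' x = 0 \/ 3 <= deg e' x) /\
    (forall s, uniq s -> 3 <= size s -> path.cycle e' s -> g <= size s * p.-1)].
Proof.
move En: #|[set x | deg e x == 2]| => n.
elim: n e l En => [|n IH] e l En esym eirr lsym d1 ne g3 G E.
  have d2 x : deg e x != 2.
    by apply/negP => dx; have := card0_eq En x; rewrite !inE dx.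
  exists e; do 2?split => //.
    by move=> x; have := d1 x; have := d2 x; case: (deg e x) => [|[|[|m]]]; auto.
  have le x y : e x y -> l x y <= p.-1.
    move=> exy; have := E x [::] y; rewrite /= exy addn0 inE andbT.
    have -> : x != y by apply: contraTneq exy => ->; rewrite eirr.
    by move=> /(_ isT isT isT); lia.
  have lew x s : path.path e x s -> wt l x s <= size s * p.-1.
    elim: s x => //= y s IHs x /andP[exy /IHs]; have := le _ _ exy; rewrite mulSn; lia.
  move=> [|x s] // u sz; rewrite /= path.rcons_path => /andP[ps el].
  apply: leq_trans (G x s u _ ps el) _; first by move: sz => /=; lia.
  by rewrite mulSn addnC leq_add ?lew ?le.
have /card_gt0P[z] : 0 < #|[set x | deg e x == 2]| by rewrite En.
rewrite inE => /cards2P[a [b [nab Nz]]].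
have ez y : e z y = (y == a) || (y == b).
  by have := in_set2 y a b; rewrite -Nz inE.
have eza : e z a by rewrite ez eqxx.
have ezb : e z b by rewrite ez eqxx orbT.
have za : z != a by apply: contraTneq eza => <-; rewrite eirr.
have zb : z != b by apply: contraTneq ezb => <-; rewrite eirr.
have le x y : e x y -> l x y <= p.-1.
  move=> exy; have := E x [::] y; rewrite /= exy addn0 inE andbT.
  have -> : x != y by apply: contraTneq exy => ->; rewrite eirr.
  by move=> /(_ isT isT isT); lia.
(* Otherwise [z], [a], [b] form a triangle of weight at most [3 * p.-1], which is below [g]. *)
have eab : ~~ e a b.
  apply/negP => eab; have := G z [:: a; b]; rewrite /= !inE (negPf za) (negPf zb) (negPf nab).
  rewrite eza eab (esym b z) ezb => /(_ isT isT isT isT).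
  have := le _ _ eza; have := le _ _ eab; have := le b z; rewrite esym => /(_ ezb).
  lia.
have [e' [h1 h2 h3 h4 h5]] : exists e' : rel T, [/\ symmetric e', irreflexive e',
    complete_minor_le e' (contract e a z), (exists x y, e' x y) &
    (forall x, deg e' x = 0 \/ 3 <= deg e' x) /\
    (forall s, uniq s -> 3 <= size s -> path.cycle e' s -> g <= size s * p.-1)].
  apply: (IH (contract e a z) (suppress_weight l a b z)) => //.
  - have -> : [set x | deg (contract e a z) x == 2] = [set x | deg e x == 2] :\ z.
      apply/setP => x; rewrite !inE; have [->|xz] := eqVneq x z.
        by rewrite (suppress_deg0 esym eirr Nz nab).
      by rewrite (suppress_deg esym eirr Nz nab eab).
    have := cardsD1 z [set x | deg e x == 2]; rewrite En inE /deg Nz cards2 nab /=.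
    by move=> [->].
  - exact: contract_sym.
  - exact: contract_irr.
  - exact: suppress_weight_sym.
  - move=> x; have [->|xz] := eqVneq x z.
      by rewrite (suppress_deg0 esym eirr Nz nab).
    by rewrite (suppress_deg esym eirr Nz nab eab).
  - exists a, b; rewrite (suppressE esym eirr Nz nab) /joins !eqxx /=.
    by rewrite eq_sym za eq_sym zb.
  - exact: suppress_girth.
  - exact: suppress_ear.
exists e'; split => //; apply: minor_trans h3 (minor_contract _ _ _) => //.
  by rewrite esym.
by rewrite eq_sym.
Qed.

(** * Contraction of a graph of large girth to a dense minor *)

(** Every reduction removes a vertex (for an ear because [2 <= p]), so induction on [#|S|] applies.
    The double negation avoids deciding reducibility and is enough for deriving [False]. *)
Lemma irreducible_core (T : finType) (e : rel T) p :
  2 <= p -> ~ p_path_degenerate e p ->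
  ~ (forall S : {set T}, S != set0 -> ~ (forall S', ~ p_reduction e p S S')).
Proof.
move=> p2 nd h; move: nd; rewrite /p_path_degenerate.
move: [set: T] => S.
have [n] := ubnP #|S|; elim: n S => // n IH S Sn nred.
have [S0|Sn0] := eqVneq S set0; first by apply: nred; rewrite S0; constructor.
apply: (h S Sn0) => S' r; apply: (IH S'); last first.
  by move=> r'; apply: nred; apply: reducible_step r r'.
have lt (A : {set T}) x : x \in S -> x \in A -> #|S :\: A| < n.
  move=> xS xA; have := cardsID A S; have : 0 < #|S :&: A|.
    by apply/card_gt0P; exists x; rewrite inE xS.
  lia.
case: r => [x xS _|x xS _|x [|z mid] y pt u xy al sz].
- by apply: (lt _ x); rewrite ?inE.
- by apply: (lt _ x); rewrite ?inE.
- by move: sz => /=; lia.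
- apply: (lt _ z); last by rewrite !inE eqxx.
  by move: pt => /= /andP[/and3P[]].
Qed.

Lemma wt_one (T : finType) (x : T) s : wt (fun _ _ => 1) x s = size s.
Proof. by elim: s x => //= y s IH x; rewrite IH. Qed.

Lemma core_minor (T : finType) (e : rel T) (S : {set T}) p g :
  simple_graph e -> girth_ge e g -> 2 <= p -> 3 * p.-1 < g ->
  S != set0 -> (forall S', ~ p_reduction e p S S') ->
  exists e' : rel T, [/\ symmetric e', irreflexive e', complete_minor_le e' e,
    (exists x y, e' x y) &
    (forall x, deg e' x = 0 \/ 3 <= deg e' x) /\
    (forall s, uniq s -> 3 <= size s -> path.cycle e' s -> g <= size s * p.-1)].
Proof.
move=> [esym eirr] gth p2 g3 Sn0 irred.
have isym : symmetric (induced e S) by move=> x y; rewrite /induced esym andbCA.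
have iirr : irreflexive (induced e S) by move=> x; rewrite /induced eirr !andbF.
have degE x : x \in S -> deg (induced e S) x = deg_in e S x.
  by move=> xS; apply: eq_card => y; rewrite !inE /induced xS.
have deg0 x : x \notin S -> deg (induced e S) x = 0.
  by move=> xS; apply: eq_card0 => y; rewrite !inE /induced (negPf xS).
have pse x s : path.path (induced e S) x s -> path.path e x s.
  by apply: path.sub_path => u v /and3P[].
have [|||| e' [h1 h2 h3 h4 h5]] := @suppress_all T (induced e S) (fun _ _ => 1) p g
  isym iirr (fun _ _ => erefl) _ _ g3 _ _.
- move=> x; have [xS|xS] := boolP (x \in S); last by rewrite deg0.
  by rewrite degE //; apply/eqP => d1; case: (irred (S :\ x)); apply: red_leaf.
- have /set0Pn[x xS] := Sn0.
  have : deg_in e S x != 0.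
    by apply/eqP => d1; case: (irred (S :\ x)); apply: red_isolated.
  rewrite -lt0n => /card_gt0P[y]; rewrite inE => /andP[yS exy].
  by exists x, y; apply/and3P.
- move=> x s u sz ps el; rewrite wt_one addn1.
  apply: (gth (x :: s)) => //=.
  by rewrite path.rcons_path (pse _ _ ps); case/and3P: el.
- move=> x s y ps u al; rewrite wt_one size_rcons ltnNge; apply/negP => sz.
  apply: (irred (S :\: [set z in s])); apply: (red_ear ps u) => //.
    by move: u; rewrite /= mem_rcons inE negb_or => /andP[/andP[]].
  apply/allP => z zs; have /allP/(_ z zs) := al.
  have [zS|zS] := boolP (z \in S); first by rewrite degE.
  by rewrite deg0.
exists e'; split => //; apply: minor_trans h3 (minor_subrel _).
by move=> x y /and3P[].
Qed.

(** * Oriented edges and the growth of balls *)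

Section Darts.
Variables (T : finType).

Definition darts (e : rel T) : {set T * T} := [set d | e d.1 d.2].

Lemma card_darts (e : rel T) (A : {set T}) :
  #|[set d in darts e | d.1 \in A]| = \sum_(x in A) deg e x.
Proof.
rewrite -sum1_card (eq_bigr (fun x => \sum_(y | e x y) 1)); last first.
  by move=> x _; rewrite sum1_card; apply: eq_card => y; rewrite !inE.
rewrite pair_big_dep /=; apply: eq_bigl => -[x y].
by rewrite !inE /= andbC.
Qed.

Lemma card_darts_all (e : rel T) : #|darts e| = \sum_x deg e x.
Proof.
have := card_darts e [set: T].
have -> : [set d in darts e | d.1 \in [set: T]] = darts e.
  by apply/setP => d; rewrite !inE andbT.
by move=> ->; apply: eq_bigl => x; rewrite inE.
Qed.

End Darts.

Section Balls.
Variables (T : finType) (e : rel T).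
Hypotheses (esym : symmetric e) (eirr : irreflexive e).
Hypothesis deg3 : forall x, deg e x = 0 \/ 3 <= deg e x.

(** The ends of non-backtracking walks of length [r] from [v] that do not start towards [u]: the
    last level of the tree hanging off the edge [u v]. *)
Fixpoint far r u v : {set T} :=
  if r is r'.+1 then \bigcup_(w in nbh e v :\ u) far r' v w else [set v].

Lemma far_walk r u v y : e u v -> y \in far r u v ->
  exists s, [/\ size s = r, nbwalk e (u :: v :: s) & last v s = y].
Proof.
elim: r u v => [|r IH] u v euv /=.
  by rewrite inE => /eqP->; exists [::]; rewrite /= euv.
case/bigcupP => w; rewrite !inE => /andP[wu evw] /(IH _ _ evw)[s [sz nb ls]].
exists (w :: s); split => //=; first by rewrite sz.
by rewrite euv eq_sym wu.
Qed.

(** [v] has two neighbours other than [u], and their far sets are disjoint: a common vertex would be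
    the end of two different non-backtracking walks from [v] of total length below [g]. *)
Lemma card_far g r u v : girth_ge e g -> 2 * r < g -> e u v -> 2 ^ r <= #|far r u v|.
Proof.
move=> gth; elim: r u v => [|r IH] u v rg euv /=; first by rewrite cards1.
have : 1 < #|nbh e v :\ u|.
  have := cardsD1 u (nbh e v); rewrite inE esym euv -/(deg e v).
  case: (deg3 v) => [d0|]; last by lia.
  by have := card0_eq d0 u; rewrite inE esym euv.
case/card_gt1P => w1 [w2 [h1 h2 nw]].
have ew1 : e v w1 by move: h1; rewrite !inE => /andP[].
have ew2 : e v w2 by move: h2; rewrite !inE => /andP[].
have dis : [disjoint far r v w1 & far r v w2].
  rewrite -setI_eq0; apply/set0Pn => -[y]; rewrite inE => /andP[].
  case/(far_walk ew1) => s1 [sz1 nb1 l1] /(far_walk ew2)[s2 [sz2 nb2 l2]].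
  suff [E] : w1 :: s1 = w2 :: s2 by rewrite E eqxx in nw.
  apply: nbwalk_unique gth nb1 nb2 _ _ => //=; first by rewrite l1.
  by rewrite sz1 sz2; lia.
have sub : far r v w1 :|: far r v w2 \subset far r.+1 u v.
  rewrite subUset; apply/andP; split.
    exact: (bigcup_sup w1).
  exact: (bigcup_sup w2).
apply: leq_trans (subset_leq_card sub).
rewrite cardsU disjoint_setI0 // cards0 subn0 expnS.
by rewrite mul2n -addnn leq_add // IH //; apply: leq_ltn_trans rg; rewrite leq_mul2l leqnSn.
Qed.

Fixpoint ball r v : {set T} :=
  if r is r'.+1 then ball r' v :|: \bigcup_(w in nbh e v) ball r' w else [set v].

Lemma far_ball r u v : far r u v \subset ball r v.
Proof.
elim: r u v => [|r IH] u v //=; apply/bigcupsP => w; rewrite inE => /andP[_ vw].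
apply: subset_trans (IH v w) _; apply: subset_trans (subsetUr _ _).
exact: (bigcup_sup w).
Qed.

Lemma ball_deg r v : 0 < deg e v -> ball r v \subset [set x | 0 < deg e x].
Proof.
elim: r v => [|r IH] v dv /=; first by rewrite sub1set inE.
rewrite subUset IH //=; apply/bigcupsP => w; rewrite inE => evw; apply: IH.
by apply/card_gt0P; exists v; rewrite inE esym.
Qed.

Lemma card_ball g r v : girth_ge e g -> 2 * r < g -> 0 < deg e v -> 2 ^ r <= #|ball r v|.
Proof.
move=> gth rg /card_gt0P[u]; rewrite inE => evu.
apply: leq_trans (subset_leq_card (far_ball r u v)).
by apply: card_far gth rg _; rewrite esym.
Qed.

End Balls.

(** * Greedy covering *)

Section GreedyCover.
Variables (T : finType) (N : T -> {set T}) (w : T -> nat) (V : {set T}) (q : nat).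
Hypothesis NV : forall v, 0 < w v -> N v \subset V.
Hypothesis Nq : forall v, 0 < w v -> q <= #|N v|.
Hypotheses (q0 : 0 < q) (qV : q <= #|V|).

Definition uncovered (X : {set T}) := \sum_(v | [disjoint N v & X]) w v.
Let W := \sum_v w v.

(** Double counting: the weights newly covered by the various [x] in [V] sum to at least
    [q * uncovered X], so the best [x] covers a proportion of at least [q / #|V|]. *)
Lemma uncovered_step (X : {set T}) :
  exists2 x, x \in V & #|V| * uncovered (x |: X) + q * uncovered X <= #|V| * uncovered X.
Proof.
pose gain x := \sum_(v | [disjoint N v & X] && (x \in N v)) w v.
have gE x : uncovered X = gain x + uncovered (x |: X).
  rewrite /uncovered (bigID (fun v => x \in N v)) /=; congr (_ + _).
  apply: eq_bigl => v; rewrite -!setI_eq0 setIUr setU_eq0 andbC; congr (_ && _).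
  by rewrite setI_eq0 disjoint_sym disjoints1.
have tot : q * uncovered X <= \sum_(x in V) gain x.
  rewrite /gain (exchange_big_dep (fun v => [disjoint N v & X])) /=; last by move=> ? ? _ /andP[].
  rewrite /uncovered big_distrr /=; apply: leq_sum => v dv.
  have [->|wv] := posnP (w v); first by rewrite muln0.
  rewrite sum_nat_const mulnC [X in _ <= X]mulnC leq_mul2l; apply/orP; right.
  apply: leq_trans (Nq wv) _; apply: subset_leq_card; apply/subsetP => x xN.
  by rewrite unfold_in /= dv xN (subsetP (NV wv)).
have [x0 x0V] : exists x, x \in V by apply/card_gt0P; lia.
pose x := [arg max_(x > x0 in V) gain x].
have [xV xmax] : x \in V /\ forall y, y \in V -> gain y <= gain x.
  by rewrite /x; case: arg_maxnP.
exists x => //.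
have : \sum_(x in V) gain x <= #|V| * gain x.
  by rewrite -sum_nat_const; apply: leq_sum.
by have := gE x; nia.
Qed.

(** While more than [W / 12] is uncovered, a step covers at least [q * W / (12 * #|V|)], so about
    [12 * #|V| / q] steps suffice. Rounding up costs at most [#|V| / q] since [q <= #|V|], whence
    13. *)
Lemma greedy_cover : exists X : {set T},
  [/\ X \subset V, 12 * uncovered X <= W & q * #|X| <= 13 * #|V|].
Proof.
have step j : exists X : {set T}, [/\ X \subset V, #|X| <= j &
    12 * uncovered X <= W \/ 12 * #|V| * uncovered X + j * q * W <= 12 * #|V| * W].
  elim: j => [|j [X [XV Xj alt]]].
    exists set0; rewrite sub0set cards0; split => //; right.
    rewrite !mul0n addn0 leq_mul2l; apply/orP; right.
    by rewrite /uncovered /W big_mkcond /=; apply: leq_sum => v _; case: ifP.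
  case: alt => alt; first by exists X; split => //; [lia | left].
  have [le|gt] := leqP (12 * uncovered X) W.
    by exists X; split => //; [lia | left].
  have [x xV hx] := uncovered_step X.
  exists (x |: X); split.
  - by rewrite subUset sub1set xV.
  - by rewrite cardsU1; lia.
  right; nia.
have [X [XV Xj alt]] := step (12 * #|V| %/ q).+1.
have jq1 := ltn_ceil (12 * #|V|) q0.
have jq2 := leq_trunc_div (12 * #|V|) q.
exists X; split => //; last by nia.
case: alt => // alt; nia.
Qed.

End GreedyCover.

(** * Cells of a breadth-first forest *)

Section Cells.
Variables (T : finType) (e : rel T).
Hypotheses (esym : symmetric e) (eirr : irreflexive e).
Variable X : {set T}.

(* [cell r v] is the pair (centre, parent) of [v] in a breadth-first forest of depth [r] rooted at [X]. *)
Fixpoint cell r (v : T) : option (T * T) :=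
  if r is r'.+1 then
    if cell r' v is Some c then Some c else
    if [pick w | e v w && isSome (cell r' w)] is Some w then
      if cell r' w is Some c then Some (c.1, w) else None
    else None
  else if v \in X then Some (v, v) else None.

Definition in_cell r x v := if cell r v is Some c then c.1 == x else false.

Lemma cellS r v c : cell r v = Some c -> cell r.+1 v = Some c.
Proof. by rewrite /= => ->. Qed.

Lemma in_cellS r x v : in_cell r x v -> in_cell r.+1 x v.
Proof. by rewrite /in_cell; case E: (cell r v) => [c|] //; rewrite (cellS E). Qed.

(** Following parents leads to the centre inside the cell. A centre is its own parent: there the
    walk is trivial and [head] returns its default [v]. *)
Lemma cell_walk r v x w : cell r v = Some (x, w) -> x \in X /\
  exists s, [/\ nbwalk e (v :: s), size s <= r, last v s = x,
    all (in_cell r x) (v :: s) & head v s = w].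
Proof.
elim: r v x w => [|r IH] v x w.
  rewrite /=; case: ifP => // vX [<- <-]; split=> //; exists [::].
  by rewrite /in_cell /= vX eqxx.
case E: (cell r v) => [c|].
  rewrite (cellS E) => -[Ec]; rewrite Ec in E.
  have [xX [s [h1 h2 h3 h4 h5]]] := IH _ _ _ E; split=> //; exists s; split=> //.
    exact: leqW.
  by apply: sub_all h4 => u; exact: in_cellS.
move=> Ev; move: (Ev); rewrite /= E; case: pickP => // w' /andP[evw].
case E': (cell r w') => [[x' w2]|] //= _ [Ex Ew]; rewrite Ex Ew in E' evw *.
have [xX [s [h1 h2 h3 h4 h5]]] := IH _ _ _ E'; split=> //; exists (w :: s); split=> //.
(* The walk of the parent lies in a cell of depth [r], where [v] has no cell yet; so it does not
   return to [v]. *)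
- move: h1 h4; rewrite /= evw; case: (s) => //= z t -> /and3P[_ cz _].
  by rewrite andbT; apply: contraTneq cz => <-; rewrite /in_cell E.
- rewrite [all _ _]/= {1}/in_cell Ev eqxx /=.
  by apply: sub_all h4 => u; exact: in_cellS.
Qed.

Lemma cell_ball r v x : x \in X -> x \in ball e r v -> cell r v.
Proof.
move=> xX; elim: r v => [|r IH] v /=; first by rewrite inE => /eqP <-; rewrite xX.
case E: (cell r v) => [c|] //; rewrite inE => /orP[/IH|]; first by rewrite E.
case/bigcupP => w; rewrite inE => evw /IH cw.
case: pickP => [w' /andP[_]|/(_ w)]; first by case: (cell r w').
by rewrite evw cw.
Qed.

Definition quotient_rel r : rel T := fun x y =>
  (x != y) && [exists u, exists v, [&& e u v, in_cell r x u & in_cell r y v]].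

Lemma quotient_sym r : symmetric (quotient_rel r).
Proof.
suff h x y : quotient_rel r x y -> quotient_rel r y x.
  by move=> x y; apply/idP/idP; apply: h.
rewrite /quotient_rel eq_sym => /andP[-> /existsP[u /existsP[v /and3P[uv cu cv]]]].
by apply/existsP; exists v; apply/existsP; exists u; rewrite esym uv cu cv.
Qed.

Lemma quotient_irr r : irreflexive (quotient_rel r).
Proof. by move=> x; rewrite /quotient_rel eqxx. Qed.

Lemma quotient_supp r x y : quotient_rel r x y -> x \in X.
Proof.
rewrite /quotient_rel => /andP[_ /existsP[u /existsP[v /and3P[_ + _]]]].
rewrite /in_cell; case E: (cell r u) => [[x' w]|] //= /eqP <-.
by have [] := cell_walk E.
Qed.

Lemma quotient_minor r : complete_minor_le (quotient_rel r) e.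
Proof.
apply: (@minor_fibres _ _ _ _ (fun u => omap fst (cell r u))).
  have h x u : omap fst (cell r u) = Some x ->
    fingraph.connect (induced e [set w | omap fst (cell r w) == Some x]) u x.
    case E: (cell r u) => [[x' w]|] //= [Ex]; rewrite Ex in E.
    have [_ [s [h1 _ h3 h4 _]]] := cell_walk E.
    apply/fingraph.connectP; exists s => //.
    have inE' u' : in_cell r x u' -> u' \in [set w | omap fst (cell r w) == Some x].
      by rewrite inE /in_cell; case: (cell r u') => //= c /eqP->.
    move: (nbwalk_path h1) h4; elim: (s) (u) => // y t IH u1 /andP[e1 p] /and3P[c1 c2 c3].
    by rewrite [path.path _ _ _]/= IH ?[all _ _]/= ?c2 // andbT /induced !inE'.
  move=> x u v /h hu /h hv; apply: fingraph.connect_trans hu _.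
  rewrite fingraph.sym_connect_sym // => a b; rewrite /induced esym.
  by rewrite andbCA.
move=> x y /andP[_ /existsP[u /existsP[v /and3P[euv cu cv]]]].
exists u, v; move: cu cv; rewrite /in_cell.
by case: (cell r u) => // c /eqP<-; case: (cell r v) => // d /eqP<-.
Qed.

(* Edges of [e] inside the union of the cells that do not belong to the forest. *)
Definition cross_darts r := [set d : T * T | e d.1 d.2 &
  if (cell r d.1, cell r d.2) is (Some c, Some c') then (c.2 != d.2) && (c'.2 != d.1)
  else false].

(** The walk goes from one centre to [u], crosses to [v] and goes on to the other centre. It does
    not backtrack because neither end is the parent of the other. *)
Lemma cross_dart_walk r u v : (u, v) \in cross_darts r -> exists x y s t,
  [/\ last u s = x, last v t = y, nbwalk e (rev s ++ u :: v :: t),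
      all (in_cell r x) (u :: s) /\ all (in_cell r y) (v :: t) &
      size s <= r /\ size t <= r].
Proof.
rewrite inE /= => /andP[euv].
case Eu: (cell r u) => [[x a]|] //; case Ev: (cell r v) => [[y b]|] //= /andP[av bu].
have [_ [s [s1 s2 s3 s4 s5]]] := cell_walk Eu.
have [_ [t [t1 t2 t3 t4 t5]]] := cell_walk Ev.
exists x, y, s, t; split => //; apply: nbwalk_join.
  have : nbwalk e (v :: u :: s).
    move: s1 s5; rewrite /= esym euv; case: (s) => //= h s' -> Eh.
    by rewrite Eh eq_sym av.
  move/(nbwalk_rev esym).
  by rewrite -cat1s rev_cat -[u :: s]cat1s rev_cat -catA.
move: t1 t5; rewrite /= euv; case: (t) => //= h s' -> Eh.
by rewrite Eh eq_sym bu.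
Qed.

Lemma in_cell_uniq r x y v : in_cell r x v -> in_cell r y v -> x = y.
Proof. by rewrite /in_cell; case: (cell r v) => // c /eqP<- /eqP<-. Qed.

(** A dart is sent to the centres of its ends, which differ since otherwise its walk would be closed
    and too short. Two darts with the same image give walks of total length at most [4 * r + 2]
    between the same centres; these coincide, and the dart is where the walk changes cell. *)
Lemma card_cross_darts g r : girth_ge e g -> 4 * r + 2 < g ->
  #|cross_darts r| <= #|darts (quotient_rel r)|.
Proof.
move=> gth gr.
pose f (d : T * T) := (odflt d.1 (omap fst (cell r d.1)), odflt d.2 (omap fst (cell r d.2))).
have ctr x u : in_cell r x u -> odflt u (omap fst (cell r u)) = x.
  by rewrite /in_cell; case: (cell r u) => // c /eqP.
have cross_neq u v x y : (u, v) \in cross_darts r -> in_cell r x u -> in_cell r y v -> x != y.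
  move=> /cross_dart_walk[x' [y' [s [t [ls lt nb [As At] [sz1 sz2]]]]]] cx cy.
  have Ex := in_cell_uniq cx (proj1 (andP As)); have Ey := in_cell_uniq cy (proj1 (andP At)).
  rewrite -Ex in ls; rewrite -Ey in lt; apply/negP => /eqP Exy.
  have := nbwalk_uniq eirr gth nb; rewrite size_cat size_rev /=.
  move=> /(_ ltac:(clear -sz1 sz2 gr; lia)).
  rewrite -cat1s catA cat_uniq => /and3P[_ /hasPn/(_ y) + _].
  rewrite -{1}lt mem_last => /(_ isT); rewrite mem_cat mem_rev inE orbC => /negP[].
  by rewrite -Exy -ls -in_cons mem_last.
rewrite -(card_in_imset (f := f) (D := cross_darts r)).
  apply: subset_leq_card; apply/subsetP => _ /imsetP[[u v] uv ->].
  have [x [y [s [t [_ _ _ [/andP[cx _] /andP[cy _]] _]]]]] := cross_dart_walk uv.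
  rewrite inE /f /= (ctr _ _ cx) (ctr _ _ cy) /quotient_rel (cross_neq u v) //=.
  apply/existsP; exists u; apply/existsP; exists v; rewrite cx cy.
  by move: uv; rewrite inE => /andP[->].
move=> [u v] [u' v'] uv uv'.
have [x [y [s [t [ls lt nb [As At] [sz1 sz2]]]]]] := cross_dart_walk uv.
have [x' [y' [s' [t' [ls' lt' nb' [As' At'] [sz1' sz2']]]]]] := cross_dart_walk uv'.
have [cx cy cx' cy'] : [/\ in_cell r x u, in_cell r y v, in_cell r x' u' & in_cell r y' v'].
  by case/andP: As; case/andP: At; case/andP: As'; case/andP: At'.
rewrite /f /= (ctr _ _ cx) (ctr _ _ cy) (ctr _ _ cx') (ctr _ _ cy') => -[Ex Ey].
have xy := cross_neq _ _ _ _ uv cx cy.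
have {}Ex : x' = x by rewrite Ex. have {}Ey : y' = y by rewrite Ey.
rewrite Ex in ls' As' cx'; rewrite Ey in lt' At' cy'.
have h (a b : T) (p q : seq T) : last a p = x ->
    rev p ++ a :: b :: q = x :: behead (rev p ++ a :: b :: q).
  move=> lp; rewrite -cat1s catA cats1 -rev_cons lastI rev_rcons lp.
  by [].
have E : rev s ++ u :: v :: t = rev s' ++ u' :: v' :: t'.
  rewrite (h _ _ _ _ ls) (h _ _ _ _ ls').
  congr cons; apply: (nbwalk_unique esym eirr gth (x := x)).
  - by rewrite -h.
  - by rewrite -h.
  - have hl a b p q : last a p = x -> last x (behead (rev p ++ a :: b :: q)) = last b q.
      move=> lp; have := h a b p q lp => /(congr1 (last x)) /= <-.
      by rewrite last_cat.
    by rewrite !hl // lt lt'.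
  - by rewrite !size_behead !size_cat !size_rev /=; clear -sz1 sz2 sz1' sz2' gr; lia.
(* Filtering by cell cuts the common walk into its two halves, which determines the dart. *)
have filt z (A B : seq T) w : all (in_cell r z) A -> all (in_cell r w) B -> z != w ->
    filter (in_cell r z) (A ++ B) = A /\ filter (in_cell r w) (A ++ B) = B.
  move=> hA hB zw; rewrite !filter_cat.
  have n1 : filter (in_cell r z) B = [::].
    apply/eqP; rewrite -[_ == _]negbK -has_filter; apply/negP => /hasP[q qB cz].
    by move/allP: hB => /(_ q qB) /(in_cell_uniq cz) zw'; rewrite zw' eqxx in zw.
  have n2 : filter (in_cell r w) A = [::].
    apply/eqP; rewrite -[_ == _]negbK -has_filter; apply/negP => /hasP[q qB cz].
    by move/allP: hA => /(_ q qB) /(in_cell_uniq cz) zw'; rewrite zw' eqxx in zw.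
  by rewrite n1 n2 cats0 /=; split; apply/all_filterP.
have spl (a b : T) (p q : seq T) : rev p ++ a :: b :: q = rev (a :: p) ++ b :: q.
  by rewrite rev_cons cat_rcons.
rewrite !spl in E.
have rA a p : all (in_cell r x) (a :: p) -> all (in_cell r x) (rev (a :: p)).
  by rewrite all_rev.
have [f1 f2] := filt x _ _ y (rA _ _ As) At xy.
have [f1' f2'] := filt x _ _ y (rA _ _ As') At' xy.
move: f1 f2; rewrite E f1' f2' => /(can_inj revK)[-> _] [-> _].
by [].
Qed.

End Cells.

Lemma card_darts_swap (T : finType) (e : rel T) (A : {set T}) : symmetric e ->
  #|[set d in darts e | d.2 \in A]| = #|[set d in darts e | d.1 \in A]|.
Proof.
move=> esym; pose sw (d : T * T) := (d.2, d.1).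
have swK : involutive sw by case.
rewrite -(card_imset _ (can_inj swK)); apply: eq_card => -[x y].
apply/imsetP/idP => [[[a b]]|].
  by rewrite !inE /= => /andP[ab bA] [-> ->]; rewrite esym ab.
by rewrite !inE /= => /andP[xy xA]; exists (y, x); rewrite ?inE //= esym xy.
Qed.

Lemma dense_quotient (T : finType) (e : rel T) g r :
  symmetric e -> irreflexive e -> (forall x, deg e x = 0 \/ 3 <= deg e x) ->
  (exists x y, e x y) -> girth_ge e g -> 4 * r + 2 < g ->
  exists (X : {set T}) (e' : rel T),
    [/\ symmetric e', irreflexive e', complete_minor_le e' e,
        (forall x y, e' x y -> x \in X) &
        0 < #|X| /\ 2 ^ r * #|X| <= 26 * #|darts e'|].
Proof.
move=> esym eirr deg3 [x0 [y0 e0]] gth gr.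
pose V := [set x | 0 < deg e x].
have rg : 2 * r < g by clear -gr; lia.
have x0V : x0 \in V by rewrite inE; apply/card_gt0P; exists y0; rewrite inE.
have V0 : 0 < #|V| by apply/card_gt0P; exists x0.
have NV v : 0 < deg e v -> ball e r v \subset V by apply: ball_deg.
have Nq v : 0 < deg e v -> 2 ^ r <= #|ball e r v|.
  by apply: card_ball gth rg.
have qV : 2 ^ r <= #|V|.
  have d0 : 0 < deg e x0 by move: x0V; rewrite inE.
  exact: leq_trans (Nq _ d0) (subset_leq_card (NV _ d0)).
have [X [XV unc szX]] := greedy_cover NV Nq (expn_gt0 2 r) qV.
exists X, (quotient_rel e X r).
pose A := [set v | [disjoint ball e r v & X]].
pose U1 := [set d in darts e | d.1 \in A].
pose U2 := [set d in darts e | d.2 \in A].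
pose P1 := [set d in darts e | if cell e X r d.1 is Some c then c.2 == d.2 else false].
pose P2 := [set d in darts e | if cell e X r d.2 is Some c then c.2 == d.1 else false].
have cU1 : #|U1| = uncovered (ball e r) (deg e) X.
  by rewrite card_darts; apply: eq_bigl => v; rewrite inE.
have cU2 : #|U2| = #|U1| by exact: card_darts_swap.
have cP1 : #|P1| <= #|V|.
  rewrite -(card_in_imset (f := @fst T T) (D := P1)).
    apply: subset_leq_card; apply/subsetP => _ /imsetP[[x y] h ->].
    move: h; rewrite !inE => /andP[xy _].
    by apply/card_gt0P; exists y; rewrite inE.
  move=> [x y] [x' y']; rewrite !inE /= => /andP[_ h] /andP[_ h'] Ex.
  by move: h h'; rewrite Ex; case: (cell e X r x') => // c /eqP<- /eqP<-.
have cP2 : #|P2| <= #|V|.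
  rewrite -(card_in_imset (f := @snd T T) (D := P2)).
    apply: subset_leq_card; apply/subsetP => _ /imsetP[[x y] h ->].
    move: h; rewrite !inE => /andP[xy _].
    by apply/card_gt0P; exists x; rewrite inE esym.
  move=> [x y] [x' y']; rewrite !inE /= => /andP[_ h] /andP[_ h'] Ey.
  by move: h h'; rewrite Ey; case: (cell e X r y') => // c /eqP<- /eqP<-.
have sub : darts e \subset cross_darts e X r :|: P1 :|: P2 :|: U1 :|: U2.
  apply/subsetP => -[x y]; rewrite !inE /= => exy; rewrite exy /=.
  have cov v : ~~ [disjoint ball e r v & X] -> cell e X r v.
    rewrite disjoint_sym => /pred0Pn[u /andP[/= uX uv]]; exact: cell_ball uX uv.
  case dx: [disjoint ball e r x & X]; first by rewrite !orbT.
  case dy: [disjoint ball e r y & X]; first by rewrite !orbT.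
  move: (cov x (negbT dx)) (cov y (negbT dy)).
  case: (cell e X r x) => // c _; case: (cell e X r y) => // c' _.
  by case: (c.2 == y); case: (c'.2 == x).
have cD : #|darts e| <= #|cross_darts e X r| + #|P1| + #|P2| + #|U1| + #|U2|.
  apply: leq_trans (subset_leq_card sub) _.
  by do 4!(apply: leq_trans (leq_card_setU _ _) _; rewrite ?leq_add2r).
have W3 : 3 * #|V| <= #|darts e|.
  rewrite card_darts_all mulnC -sum_nat_const [X in X <= _]big_mkcond.
  apply: leq_sum => x _; rewrite inE; case: (deg3 x) => [->|] //.
  by case: ifP.
have cr := card_cross_darts esym eirr X gth gr.
(* Forest darts number at most [2 * #|V|], two thirds of all darts by [W3]; darts with an uncovered
   end make up at most one sixth. At least one sixth remains, hence at least [#|V| / 2]. *)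
have n2 : #|V| <= 2 * #|cross_darts e X r|.
  move: unc; rewrite -card_darts_all -cU1.
  by clear -cD cU2 cP1 cP2 W3; lia.
have fin : 2 ^ r * #|X| <= 26 * #|darts (quotient_rel e X r)|.
  apply: leq_trans szX _; apply: (@leq_trans (13 * (2 * #|cross_darts e X r|))).
    by rewrite leq_mul2l n2 orbT.
  by rewrite mulnA leq_mul2l cr orbT.
have X0 : 0 < #|X|.
  case: posnP => // X0; exfalso.
  have XE : X = set0 by apply/eqP; rewrite -cards_eq0 X0.
  have AE : A = setT by apply/setP => v; rewrite !inE XE -setI_eq0 setI0 eqxx.
  move: unc; rewrite -card_darts_all -cU1 /U1 AE.
  have -> : [set d in darts e | d.1 \in setT] = darts e by apply/setP => d; rewrite !inE andbT.
  by move: W3; clear -V0; lia.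
split => //.
- exact: quotient_sym.
- exact: quotient_irr.
- exact: quotient_minor.
- exact: quotient_supp.
Qed.

(** * Complete minors in dense graphs *)

(** Random choices with repetition are treated by counting tuples. *)
Definition tuples_in (T : finType) t (A : {set T}) : {set {ffun 'I_t -> T}} :=
  [set f : {ffun 'I_t -> T} | [forall i, f i \in A]].

Lemma card_tuples_in (T : finType) t (A : {set T}) : #|tuples_in t A| = #|A| ^ t.
Proof.
have := card_ffun_on 'I_t A; rewrite card_ord => <-.
by apply: eq_card => f; rewrite inE; apply/forallP/ffun_onP.
Qed.

Section DenseGraph.
Variables (T : finType) (e : rel T) (S : {set T}) (s k : nat).
Hypotheses (esym : symmetric e) (eS : forall x y, e x y -> x \in S).
Let N := #|S|.
Hypothesis mindeg : forall x, x \in S -> N <= 2 * deg e x.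
Hypothesis common : forall x y, x \in S -> y \in S -> N <= 6 * #|nbh e x :&: nbh e y|.
Hypotheses (s0 : 0 < s) (k0 : 0 < k) (ks : k <= 2 ^ (s * s)) (kN : 200 * (s * k) <= N).
(** A vertex of [S] is non-adjacent to at most three quarters of the candidates. With this [t], the
    inequality [2 ^ s.+2 * 3 ^ t <= 4 ^ t] is a power of [54 <= 64]. *)
Let t := 3 * s.+2.

Definition missed (B : {set T}) : {set T} := [set y in S | [disjoint nbh e y & B]].

Definition branch_set (B : {set T}) :=
  [/\ B \subset S, B != set0, connected_in e B, #|B| <= 2 * t
    & #|missed B| * 2 ^ s.+1 <= N].

Definition linked (A B : {set T}) :=
  [disjoint A & B] /\ exists x y, [/\ x \in A, y \in B & e x y].

Lemma missedS (A B : {set T}) : A \subset B -> missed B \subset missed A.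
Proof.
move=> AB; apply/subsetP => y; rewrite !inE => /andP[-> dB] /=.
exact: disjointWr AB dB.
Qed.

Section Choice.
Variables (j : nat) (B : nat -> {set T}) (U : {set T}).
Hypotheses (jk : j < k) (good : forall i, i < j -> branch_set (B i)).
Hypothesis (US : 11 * #|U| <= N).
Let V := S :\: U.
Let v := #|V|.

Let vN : N <= 2 * v.
Proof.
have := cardsID U S; rewrite -/V -/v -/N.
have := subset_leq_card (subsetIr S U); move: US; clear; lia.
Qed.

Let v0 : 0 < v.
Proof. by move: vN kN; have := muln_gt0 s k; rewrite s0 k0; clear; lia. Qed.

Let missV y : y \in S -> 4 * #|V :\: nbh e y| <= 3 * v.
Proof.
move=> yS; have := cardsID (nbh e y) V; rewrite -/v.
have h : deg e y <= #|V :&: nbh e y| + #|U|.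
  apply: leq_trans (leq_card_setU _ _); apply: subset_leq_card; apply/subsetP => x.
  rewrite !inE => exy; rewrite exy andbT.
  by have := eS; move=> /(_ x y); rewrite esym => /(_ exy) ->; rewrite andbT; case: (x \in U).
have vle : v <= N by apply: subset_leq_card; exact: subsetDl.
by have := mindeg yS; move: h vle US; clear; lia.
Qed.

Definition ran (f : {ffun 'I_t -> T}) : {set T} := [set f i | i : 'I_t].

Let sum_missed : 4 ^ t * \sum_(f in tuples_in t V) #|missed (ran f)| <= N * (3 ^ t * v ^ t).
Proof.
have -> : \sum_(f in tuples_in t V) #|missed (ran f)| =
    \sum_(y in S) #|tuples_in t (V :\: nbh e y)|.
  under eq_bigr => f _ do rewrite -sum1_card.
  rewrite (exchange_big_dep (mem S)) /=; last first.
    by move=> f y _; rewrite !inE => /andP[].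
  apply: eq_bigr => y yS; rewrite sum1_card; apply: eq_card => f.
  rewrite unfold_in /= !inE yS /=; apply/andP/forallP.
    move=> [/forallP fV dis] i; rewrite !inE; move: (fV i); rewrite !inE => ->.
    rewrite andbT; apply/negP => efy; move/pred0P: dis => /(_ (f i)) /=.
    by rewrite !inE efy /= => /negP[]; apply/imsetP; exists i.
  move=> h; split.
    by apply/forallP => i; have := h i; rewrite !inE => /andP[].
  apply/pred0P => x /=; apply/negP => /andP[xy /imsetP[i _ xE]].
  by have := h i; rewrite -xE !inE; move: xy; rewrite inE => ->.
rewrite big_distrr /= /N -sum_nat_const; apply: leq_sum => y yS.
by rewrite card_tuples_in -!expnMn leq_exp2r // missV.
Qed.

Let bad1 := [set f in tuples_in t V | N < #|missed (ran f)| * 2 ^ s.+1].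
Let bad2 i := tuples_in t (V :&: missed (B i)).

(** Markov's inequality applied to [sum_missed]; the factor [N.+1], available since bad tuples
    exceed [N] strictly, makes the bound strict. *)
Let card_bad1 : 2 * #|bad1| < v ^ t.
Proof.
have h1 : N.+1 * #|bad1| <= 2 ^ s.+1 * \sum_(f in tuples_in t V) #|missed (ran f)|.
  rewrite mulnC -sum_nat_const big_distrr /=.
  rewrite [X in _ <= X](bigID (fun f => f \in bad1)) /=; apply: leq_trans (leq_addr _ _).
  rewrite (eq_bigl (fun f => (f \in tuples_in t V) && (f \in bad1))).
    by apply: leq_sum => f /andP[_]; rewrite inE => /andP[_]; rewrite mulnC.
  by move=> f; rewrite inE andbA andbb.
have h2 : 2 * (2 ^ s.+1 * 3 ^ t) <= 4 ^ t.
  by rewrite mulnA -expnS /t !expnM -expnMn leq_exp2r.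
have vt : 0 < v ^ t by rewrite expn_gt0 v0.
have p4 : 0 < 4 ^ t by rewrite expn_gt0.
have h3 : 4 ^ t * (N.+1 * (2 * #|bad1|)) <= 4 ^ t * (N * v ^ t).
  apply: (@leq_trans (2 * 2 ^ s.+1 * (4 ^ t * \sum_(f in tuples_in t V) #|missed (ran f)|))).
    have -> : 4 ^ t * (N.+1 * (2 * #|bad1|)) = 2 * 4 ^ t * (N.+1 * #|bad1|) 
      by move: (4 ^ t) N.+1 #|bad1| => a b c; clear; lia.
    apply: leq_trans (leq_mul (leqnn _) h1) _.
    by move: (4 ^ t) (2 ^ s.+1) (\sum_(f in _) _) => a b c; clear; lia.
  apply: leq_trans (leq_mul (leqnn _) sum_missed) _.
  have -> : 2 * 2 ^ s.+1 * (N * (3 ^ t * v ^ t)) = (2 * (2 ^ s.+1 * 3 ^ t)) * (N * v ^ t).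
    by move: (2 ^ s.+1) (3 ^ t) (v ^ t) N => a b c d; clear; lia.
  exact: leq_mul.
rewrite leq_pmul2l // in h3.
rewrite ltnNge; apply/negP => h4.
have : N.+1 * v ^ t <= N * v ^ t by apply: leq_trans h3; rewrite leq_mul2l h4 orbT.
by rewrite leq_mul2r ltnn orbF => /eqP E; rewrite E in vt.
Qed.

(** A tuple counted in [bad2 i] has all entries in a set of at most [v / 2 ^ s] elements. The union
    bound over [j < k] indices then uses [2 * k <= 2 ^ (s * t)]. *)
Let card_bad2 : 2 * \sum_(i < j) #|bad2 i| <= v ^ t.
Proof.
have h1 (i : 'I_j) : 2 ^ (s * t) * #|bad2 i| <= v ^ t.
  rewrite /bad2 card_tuples_in expnM -expnMn leq_exp2r //.
  have [_ _ _ _ h] := good (ltn_ord i).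
  have := subset_leq_card (subsetIr V (missed (B i))).
  move: h vN; rewrite expnS; move: (2 ^ s) => q; clear; nia.
have h2 : 2 ^ (s * t) * \sum_(i < j) #|bad2 i| <= k * v ^ t.
  rewrite big_distrr /=; apply: leq_trans (leq_sum _ (fun i _ => h1 i)) _.
  by rewrite sum_nat_const card_ord leq_mul2r (ltnW jk) orbT.
have h3 : 2 * k <= 2 ^ (s * t).
  apply: (@leq_trans (2 ^ (s * s).+1)); first by rewrite expnS leq_mul2l ks orbT.
  by rewrite leq_exp2l // /t; move: s0; clear; nia.
have k2 : 0 < k by [].
rewrite -(leq_pmul2l k2); apply: leq_trans h2.
by rewrite mulnA [k * 2]mulnC leq_mul2r h3 orbT.
Qed.

Lemma tuple_choice : exists f : {ffun 'I_t -> T},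
  [/\ forall i, f i \in V, #|missed (ran f)| * 2 ^ s.+1 <= N
    & forall i, i < j -> exists2 a, f a \in S & f a \notin missed (B i)].
Proof.
have cOm : #|tuples_in t V| = v ^ t by rewrite card_tuples_in.
pose bad := bad1 :|: \bigcup_(i < j) bad2 i.
have lt : #|bad| < #|tuples_in t V|.
  apply: leq_ltn_trans (leq_card_setU _ _) _.
  have : #|\bigcup_(i < j) bad2 i| <= \sum_(i < j) #|bad2 i|.
    elim/big_rec2: _ => [|i a A _ IH]; first by rewrite cards0.
    by apply: leq_trans (leq_card_setU _ _) _; rewrite leq_add2l.
  by rewrite cOm; move: card_bad1 card_bad2; clear; lia.
have : ~~ (tuples_in t V \subset bad) by apply/negP => /subset_leq_card; rewrite leqNgt lt.
case/subsetPn => f fT; rewrite inE negb_or => /andP[n1 n2].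
have fV i : f i \in V by move: fT; rewrite inE => /forallP.
exists f; split => //.
- by move: n1; rewrite inE fT /= -leqNgt.
move=> i ij; have : f \notin bad2 i.
  by apply: contra n2 => h; apply/bigcupP; exists (Ordinal ij).
rewrite inE negb_forall => /existsP[a].
rewrite inE fV /= => ha; exists a => //; have := fV a.
by rewrite inE => /andP[].
Qed.

(** Each [f i] is linked to [a] through a common neighbour outside [U], which exists because [#|U|]
    is at most [N / 11] and common neighbours number at least [N / 6]. This at most doubles the size
    [t]. *)
Lemma next_branch_set : (forall i, i < j -> B i \subset U) ->
  exists A, [/\ branch_set A, [disjoint A & U] & forall i, i < j -> linked (B i) A].
Proof.
move=> BU; have [f [fV fm fB]] := tuple_choice.
have t0 : 0 < t by [].
pose a := f (Ordinal t0).
have fS i : f i \in S by have := fV i; rewrite inE => /andP[].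
have fU i : f i \notin U by have := fV i; rewrite inE => /andP[].
have cex i : exists c, [&& e a c, e (f i) c & c \notin U].
  have : ~~ (nbh e a :&: nbh e (f i) \subset U).
    apply/negP => /subset_leq_card; have := common (fS (Ordinal t0)) (fS i).
    rewrite -/a; move: US kN; have : 0 < s * k by rewrite muln_gt0 s0.
    clear; lia.
  by case/subsetPn => c; rewrite !inE => /andP[h1 h2] h3; exists c; rewrite h1 h2.
pose c i := xchoose (cex i).
have cP i : [/\ e a (c i), e (f i) (c i) & c i \notin U] by apply/and3P; exact: xchooseP (cex i).
pose A := ran f :|: [set c i | i : 'I_t].
have fA i : f i \in A by rewrite inE; apply/orP; left; apply/imsetP; exists i.
have cA i : c i \in A by rewrite inE; apply/orP; right; apply/imsetP; exists i.
have AP x : x \in A -> (exists i, x = f i) \/ (exists i, x = c i).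
  by rewrite inE => /orP[] /imsetP[i _ ->]; [left|right]; exists i.
exists A; split.
- split.
  + apply/subsetP => x /AP[[i ->]|[i ->]] //.
    by have [h _ _] := cP i; apply: (eS (y := a)); rewrite esym.
  + by apply/set0Pn; exists a; exact: fA.
  + have toa x : x \in A -> fingraph.connect (induced e A) x a.
      case/AP => [[i ->]|[i ->]]; have [h1 h2 _] := cP i; last first.
        by apply: fingraph.connect1; rewrite /induced cA fA esym.
      apply: (@fingraph.connect_trans _ _ (c i)).
        by apply: fingraph.connect1; rewrite /induced cA fA.
      by apply: fingraph.connect1; rewrite /induced cA fA esym.
    move=> x y xA yA; apply: fingraph.connect_trans (toa x xA) _.
    rewrite fingraph.sym_connect_sym; first exact: toa.
    by move=> u w; rewrite /induced esym andbCA.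
  + apply: leq_trans (leq_card_setU _ _) _; rewrite mul2n -addnn.
    by apply: leq_add; apply: leq_trans (leq_imset_card _ _) _; rewrite card_ord.
  + apply: leq_trans fm; rewrite leq_mul2r; apply/orP; right.
    by apply: subset_leq_card; apply: missedS; exact: subsetUl.
- rewrite disjoint_subset; apply/subsetP => x /AP[[i ->]|[i ->]]; rewrite inE //.
  by have [] := cP i.
- move=> i ij; split.
    rewrite disjoint_subset; apply/subsetP => x /(subsetP (BU i ij)) xU; rewrite inE.
    apply/negP => /AP[[i' E]|[i' E]]; first by move: (fU i'); rewrite -E xU.
    by have [_ _] := cP i'; rewrite -E xU.
  have [m mS] := fB i ij; rewrite inE mS /= => /pred0Pn[x /andP[/= xm xB]].
  by exists x, (f m); split => //; move: xm; rewrite inE esym.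
Qed.

End Choice.

Lemma dense_minor : has_K_minor e k.
Proof.
have seqB j : j <= k -> exists B : nat -> {set T},
    (forall i, i < j -> branch_set (B i)) /\
    (forall i i', i < i' -> i' < j -> linked (B i) (B i')).
  elim: j => [|j IH] jk; first by exists (fun=> set0).
  have [B [gB lB]] := IH (ltnW jk).
  pose U := \bigcup_(i < j) B i.
  have cU : 11 * #|U| <= N.
    have h1 : #|U| <= \sum_(i < j) #|B i|.
      rewrite /U; elim/big_rec2: _ => [|i x A _ IH']; first by rewrite cards0.
      by apply: leq_trans (leq_card_setU _ _) _; rewrite leq_add2l.
    have h2 : \sum_(i < j) #|B i| <= j * (2 * t).
      rewrite -[X in X * _]card_ord -sum_nat_const; apply: leq_sum => i _.
      by have [] := gB i (ltn_ord i).
    have h3 : j * (2 * t) <= k * (2 * t) by rewrite leq_mul2r (ltnW jk) orbT.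
    (* The branch sets use at most [18 * (s * k)] vertices; [11 * 18 <= 200] keeps [U] below
       [N / 11]. *)
    have h4 : k * (2 * t) <= 18 * (s * k) by rewrite /t; move: s0; clear; nia.
    by move: h1 h2 h3 h4 kN; clear; lia.
  have BU i : i < j -> B i \subset U by move=> ij; apply: (bigcup_sup (Ordinal ij)).
  have [A [gA dA lA]] := next_branch_set jk gB cU BU.
  exists (fun i => if i == j then A else B i); split.
    move=> i; rewrite ltnS leq_eqVlt => /orP[/eqP->|ij]; first by rewrite eqxx.
    by rewrite (ltn_eqF ij); apply: gB.
  move=> i i' ii'; rewrite ltnS leq_eqVlt => /orP[/eqP E|ij].
    by rewrite E eqxx; rewrite E in ii'; rewrite (ltn_eqF ii'); apply: lA.
  by rewrite (ltn_eqF ij) (ltn_eqF (ltn_trans ii' ij)); apply: lB.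
have [B [gB lB]] := seqB k (leqnn k).
exists (fun i : 'I_k => B i); split.
- by move=> i; have [] := gB i (ltn_ord i).
- move=> i i' ne; have [lt|gt|/val_inj E] := ltngtP i i'.
  + by have [] := lB i i' lt (ltn_ord _).
  + by rewrite disjoint_sym; have [] := lB i' i gt (ltn_ord _).
  + by rewrite E eqxx in ne.
- by move=> i; have [] := gB i (ltn_ord i).
- move=> i i' ne; have [lt|gt|/val_inj E] := ltngtP i i'.
  + by have [] := lB i i' lt (ltn_ord _).
  + have [_ [x [y [h1 h2 h3]]]] := lB i' i gt (ltn_ord _).
    by exists y, x; rewrite esym.
  + by rewrite E eqxx in ne.
Qed.

End DenseGraph.

(* A graph with vertex set [S]: vertices outside [S] are isolated. *)
Definition graph_on (T : finType) (S : {set T}) (e : rel T) :=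
  [/\ symmetric e, irreflexive e & forall x y, e x y -> x \in S].

Definition del_vertex (T : finType) (e : rel T) (v : T) : rel T :=
  fun x y => [&& x != v, y != v & e x y].

Definition del_edge (T : finType) (e : rel T) (a b : T) : rel T :=
  fun x y => e x y && ~~ ((x == a) && (y == b) || (x == b) && (y == a)).

(** * Edge counts under deletion and contraction *)

Section Reductions.
Variables (T : finType) (S : {set T}) (e : rel T).
Hypothesis gr : graph_on S e.
Let esym : symmetric e. Proof. by case: gr. Qed.
Let eirr : irreflexive e. Proof. by case: gr. Qed.
Let eS x y : e x y -> x \in S. Proof. by case: gr => _ _; apply. Qed.

Lemma del_edge_graph a b : graph_on S (del_edge e a b).
Proof.
split.
- by move=> x y; rewrite /del_edge esym orbC ![(_ == a) && _]andbC.
- by move=> x; rewrite /del_edge eirr.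
- by move=> x y /andP[/eS].
Qed.

Lemma card_del_edge a b : e a b ->
  #|darts (del_edge e a b)| < #|darts e| <= #|darts (del_edge e a b)| + 2.
Proof.
move=> eab; apply/andP; split.
  apply: proper_card; apply/properP; split.
    by apply/subsetP => d; rewrite !inE => /andP[].
  by exists (a, b); rewrite inE //= /del_edge !eqxx andbF.
have sub : darts e \subset darts (del_edge e a b) :|: [set (a, b); (b, a)].
  apply/subsetP => -[x y]; rewrite !inE /del_edge /= => ->.
  by rewrite !xpair_eqE orNb.
apply: leq_trans (subset_leq_card sub) (leq_trans (leq_card_setU _ _) _).
by rewrite leq_add2l cards2; case: (_ != _).
Qed.

Lemma del_vertex_graph v : graph_on (S :\ v) (del_vertex e v).
Proof.
split.
- by move=> x y; rewrite /del_vertex esym andbCA.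
- by move=> x; rewrite /del_vertex eirr !andbF.
- by move=> x y /and3P[xv _ /eS xS]; rewrite !inE xv.
Qed.

Lemma card_del_vertex v : #|darts e| = #|darts (del_vertex e v)| + 2 * deg e v.
Proof.
pose D1 := [set d in darts e | d.1 \in [set v]].
pose D2 := [set d in darts e | d.2 \in [set v]].
have h2 : #|D2| = deg e v.
  pose sw (d : T * T) := (d.2, d.1).
  have swK : involutive sw by case.
  rewrite -(card_imset _ (can_inj swK)); have := card_darts e [set v].
  rewrite big_set1 => <-; apply: eq_card => -[x y].
  apply/imsetP/idP => [[[a b]]|].
    by rewrite !inE /= => /andP[ab bA] [-> ->]; rewrite esym ab.
  by rewrite !inE /= => /andP[xy xA]; exists (y, x); rewrite ?inE //= esym xy.
have h1 : #|D1| = deg e v by rewrite card_darts big_set1.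
have -> : darts e = darts (del_vertex e v) :|: (D1 :|: D2).
  apply/setP => -[x y]; rewrite !inE /del_vertex /=.
  by case: (x == v); case: (y == v); rewrite ?andbT ?andbF ?orbF ?orbb.
rewrite !cardsU h1 h2.
have -> : D1 :&: D2 = set0.
  apply/setP => -[x y]; rewrite !inE /=; apply/negbTE/negP.
  by move=> /andP[/andP[xy /eqP Ex] /andP[_ /eqP Ey]]; rewrite Ex Ey eirr in xy.
have -> : darts (del_vertex e v) :&: (D1 :|: D2) = set0.
  apply/setP => -[x y]; rewrite !inE /del_vertex /=.
  by case: (x == v); case: (y == v); rewrite ?andbF.
by rewrite cards0 !subn0 addnn mul2n.
Qed.

Lemma contract_graph a b : e a b -> graph_on (S :\ b) (contract e a b).
Proof.
move=> eab; split.
- exact: contract_sym.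
- exact: contract_irr.
- move=> x y /and4P[xb _ _ h]; rewrite !inE xb /=.
  by case/or3P: h => [/eS //|/andP[/eqP-> _]|/andP[_ /eS]] //; apply: eS eab.
Qed.

(** The darts at [b] move to [a]; those at common neighbours merge with existing ones, and the two
    darts of the edge itself vanish. *)
Lemma card_contract a b : e a b ->
  #|darts e| <= #|darts (contract e a b)| + (2 * #|nbh e a :&: nbh e b| + 2).
Proof.
move=> eab.
have nab : a != b by apply: contraTneq eab => ->; rewrite eirr.
pose W := (nbh e b :\: nbh e a) :\ a.
have cW : deg e b = #|W| + #|nbh e a :&: nbh e b| + 1.
  rewrite /deg -(cardsID (nbh e a) (nbh e b)) [_ :&: nbh e a]setIC.
  by rewrite (cardsD1 a (_ :\: _)) !inE eirr esym eab /=; rewrite /W; clear; lia.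
pose W1 := [set (a, w) | w in W]; pose W2 := [set (w, a) | w in W].
have cW1 : #|W1| = #|W| by rewrite card_imset // => x y [].
have cW2 : #|W2| = #|W| by rewrite card_imset // => x y [].
have WP w : w \in W -> [/\ w != a, ~~ e a w & e b w].
  by rewrite !inE => /and3P[].
have sub : darts (del_vertex e b) :|: (W1 :|: W2) \subset darts (contract e a b).
  apply/subsetP => -[x y]; rewrite !inE => /or3P[|/imsetP[w /WP[wa naw bw] [-> ->]]|/imsetP[w /WP[wa naw bw] [-> ->]]].
  - rewrite /del_vertex /contract /= => /and3P[-> -> exy]; rewrite exy andbT.
    by apply: contraTneq exy => ->; rewrite eirr.
  - rewrite /contract /= nab eqxx bw [a == w]eq_sym wa orbT !andbT.
    by apply: contraTneq bw => ->; rewrite eirr.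
  - rewrite /contract /= nab eqxx (esym w b) bw wa !orbT !andbT.
    by apply: contraTneq bw => ->; rewrite eirr.
have I1 : W1 :&: W2 = set0.
  apply/setP => d; rewrite !inE; apply/negbTE/negP => /andP[/imsetP[w /WP[wa _ _] ->]].
  by case/imsetP => w' /WP[wa' _ _] [E _]; rewrite -E eqxx in wa'.
have I2 : darts (del_vertex e b) :&: (W1 :|: W2) = set0.
  apply/setP => d; rewrite !inE; apply/negbTE/negP => /andP[h /orP[] /imsetP[w /WP[wa naw _] E]];
    move: h; rewrite E /del_vertex /= => /and3P[_ _].
    by rewrite (negPf naw).
  by rewrite esym (negPf naw).
have := subset_leq_card sub; rewrite !cardsU I1 I2 cards0 cW1 cW2 !subn0.
by rewrite (card_del_vertex b) cW; clear; lia.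
Qed.

Lemma card_darts_le : #|darts e| <= #|S| * #|S|.-1.
Proof.
rewrite -sum_nat_const card_darts_all [X in _ <= X]big_mkcond; apply: leq_sum => x _.
case: ifPn => xS.
  rewrite (cardsD1 x S) xS /=; apply: subset_leq_card; apply/subsetP => y.
  rewrite !inE => exy; apply/andP; split; last by apply: (eS (y := x)); rewrite esym.
  by apply: contraTneq exy => ->; rewrite eirr.
by rewrite leqn0; apply/eqP; apply: eq_card0 => y; rewrite !inE; apply: contraNF xS => /eS.
Qed.

Lemma exists_min_deg : 0 < #|S| -> exists2 v, v \in S & #|S| * deg e v <= #|darts e|.
Proof.
case/card_gt0P => x0 x0S; pose v := [arg min_(v < x0 in S) deg e v].
have [vS vmin] : v \in S /\ forall y, y \in S -> deg e v <= deg e y.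
  by rewrite /v; case: arg_minnP.
exists v => //; rewrite -sum_nat_const card_darts_all big_mkcond; apply: leq_sum => x _.
by case: ifP => // /vmin.
Qed.

Lemma neighbourhood_graph (A : {set T}) : graph_on A (induced e A).
Proof.
split.
- by move=> x y; rewrite /induced esym andbCA.
- by move=> x; rewrite /induced eirr !andbF.
- by move=> x y /and3P[].
Qed.

Lemma nbh_induced (A : {set T}) u : u \in A -> nbh (induced e A) u = nbh e u :&: A.
Proof. by move=> uA; apply/setP => y; rewrite !inE /induced uA /= andbC. Qed.

End Reductions.

(** Induction on vertices plus darts: as long as deleting an edge, contracting an edge or deleting a
    vertex preserves the density condition, it is done. The last three bounds say that each of these
    operations fails; [1 < #|S'|] keeps the vertex set nonempty. *)
Lemma minimal_minor (T : finType) (F : nat -> nat) a (S : {set T}) (e : rel T) :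
  graph_on S e -> 0 < #|S| -> F #|S| <= a * #|darts e| ->
  exists (S' : {set T}) (e' : rel T),
    [/\ graph_on S' e', complete_minor_le e' e, 0 < #|S'|, F #|S'| <= a * #|darts e'| &
    [/\ forall x y, e' x y -> a * #|darts e'| < F #|S'| + a * 2,
        1 < #|S'| -> forall x y, e' x y ->
          a * #|darts e'| < F #|S'|.-1 + a * (2 * #|nbh e' x :&: nbh e' y| + 2)
      & 1 < #|S'| -> forall v, v \in S' -> a * #|darts e'| < F #|S'|.-1 + a * (2 * deg e' v)]].
Proof.
have [n] := ubnP (#|S| + #|darts e|); elim: n S e => // n IH S e Sn gr S0 FS.
have [esym eirr eS] := gr.
have step (S1 : {set T}) (e1 : rel T) : graph_on S1 e1 -> complete_minor_le e1 e -> 0 < #|S1| ->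
    F #|S1| <= a * #|darts e1| -> #|S1| + #|darts e1| < #|S| + #|darts e| ->
  exists (S' : {set T}) (e' : rel T),
    [/\ graph_on S' e', complete_minor_le e' e, 0 < #|S'|, F #|S'| <= a * #|darts e'| &
    [/\ forall x y, e' x y -> a * #|darts e'| < F #|S'| + a * 2,
        1 < #|S'| -> forall x y, e' x y ->
          a * #|darts e'| < F #|S'|.-1 + a * (2 * #|nbh e' x :&: nbh e' y| + 2)
      & 1 < #|S'| -> forall v, v \in S' -> a * #|darts e'| < F #|S'|.-1 + a * (2 * deg e' v)]].
  move=> g1 m1 S10 F1 lt.
  have [|S' [e' [h1 h2 h3 h4 h5]]] := IH S1 e1 _ g1 S10 F1.
    by move: lt Sn; clear; lia.
  by exists S', e'; split => //; apply: minor_trans h2 m1.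
have cD v : v \in S -> #|S :\ v| = #|S|.-1 by move=> vS; rewrite (cardsD1 v S) vS.
case P1 : [forall x, forall y, e x y ==> (a * #|darts e| < F #|S| + a * 2)]; last first.
  move/negbT: P1; rewrite negb_forall => /existsP[x]; rewrite negb_forall => /existsP[y].
  rewrite negb_imply -leqNgt => /andP[exy le].
  have /andP[c1 c2] := card_del_edge exy.
  apply: (step S (del_edge e x y)) => //.
  - exact: del_edge_graph.
  - by apply: minor_subrel => u v /andP[].
  - rewrite -(leq_add2r (a * 2)); apply: leq_trans le _.
    by rewrite -mulnDr leq_mul2l c2 orbT.
  - by rewrite ltn_add2l.
case P2 : [forall x, forall y, e x y ==> (1 < #|S|) ==>
   (a * #|darts e| < F #|S|.-1 + a * (2 * #|nbh e x :&: nbh e y| + 2))]; last first.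
  move/negbT: P2; rewrite negb_forall => /existsP[x]; rewrite negb_forall => /existsP[y].
  rewrite !negb_imply -leqNgt => /and3P[exy S1 le].
  have yS : y \in S by apply: (eS _ x); rewrite esym.
  have nxy : x != y by apply: contraTneq exy => ->; rewrite eirr.
  apply: (step (S :\ y) (contract e x y)).
  - exact: contract_graph.
  - exact: minor_contract.
  - by rewrite cD //; move: S1; clear; lia.
  - rewrite cD // -(leq_add2r (a * (2 * #|nbh e x :&: nbh e y| + 2))).
    by apply: leq_trans le _; rewrite -mulnDr leq_mul2l (card_contract gr exy) orbT.
  - rewrite cD //; have : #|darts (contract e x y)| <= #|darts e|; last by move: S0; clear; lia.
    pose W := nbh e y.
    have sub : darts (contract e x y) \subset darts (del_vertex e y) :|:
        ([set (x, w) | w in W] :|: [set (w, x) | w in W]).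
      apply/subsetP => -[u w]; rewrite !inE /contract /del_vertex /= => /and4P[-> -> _].
      case/or3P => [->|/andP[/eqP-> yw]|/andP[/eqP-> uy]] //; apply/or3P.
        by apply: Or32; apply/imsetP; exists w; rewrite ?inE.
      by apply: Or33; apply/imsetP; exists u; rewrite ?inE // esym.
    have h (f : T -> T * T) : #|[set f w | w in W]| <= deg e y by apply: leq_imset_card.
    apply: leq_trans (subset_leq_card sub) _; apply: leq_trans (leq_card_setU _ _) _.
    rewrite (card_del_vertex gr y) leq_add2l; apply: leq_trans (leq_card_setU _ _) _.
    by rewrite mul2n -addnn leq_add.
case P3 : [forall v, (v \in S) ==> (1 < #|S|) ==>
   (a * #|darts e| < F #|S|.-1 + a * (2 * deg e v))]; last first.
  move/negbT: P3; rewrite negb_forall => /existsP[v].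
  rewrite !negb_imply -leqNgt => /and3P[vS S1 le].
  apply: (step (S :\ v) (del_vertex e v)).
  - exact: del_vertex_graph.
  - by apply: minor_subrel => x y /and3P[].
  - by rewrite cD //; move: S1; clear; lia.
  - rewrite cD // -(leq_add2r (a * (2 * deg e v))).
    by apply: leq_trans le _; rewrite -mulnDr (card_del_vertex gr v).
  - by rewrite cD // (card_del_vertex gr v); move: S0; clear; lia.
exists S, e; split => //; split.
- by move=> x y exy; move/forallP/(_ x)/forallP/(_ y): P1; rewrite exy.
- by move=> S1 x y exy; move/forallP/(_ x)/forallP/(_ y): P2; rewrite exy S1.
- by move=> S1 v vS; move/forallP/(_ v): P3; rewrite vS S1.
Qed.

(** Two minimal minors in succession. In the first, a vertex of minimum degree [n0], with
    [d < n0 <= 2 * d], has a neighbourhood whose internal degrees are at least half its size. The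
    second, for the threshold [n * (n + n0)], raises this proportion to nearly five eighths, so that
    any two vertices share many neighbours. *)
Lemma average_degree_minor (T : finType) (S : {set T}) (e : rel T) s k :
  graph_on S e -> 0 < #|S| -> 0 < s -> 1 < k -> k <= 2 ^ (s * s) ->
  2200 * (s * k) * #|S| <= #|darts e| -> has_K_minor e k.
Proof.
move=> gr S0 s0 k1 ks dens.
have sk0 : 1 < s * k by move: s0 k1; clear; nia.
(* The last neighbourhood has at least about [5 * n0 / 24] vertices; with [n0 > d] this exceeds the
   required [200 * (s * k)]. *)
pose d := 1100 * (s * k).
have d1 : 2200 <= d by rewrite /d; move: sk0; clear; lia.
have {}dens : 2 * d * #|S| <= 1 * #|darts e|.
  by rewrite mul1n; apply: leq_trans dens; rewrite leq_mul2r /d mulnA leqnn orbT.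
have [S1 [e1 [g1 m1 S10 F1 [E1 E2 E3]]]] := minimal_minor (F := fun n => 2 * d * n) gr S0 dens.
move: F1 E1 E2 E3; rewrite !mul1n => F1 E1 E2 E3.
have S11 : 1 < #|S1|.
  have := card_darts_le g1; move: F1 S10 d1; case: #|S1| => [|[|m]] //=; clear; lia.
have [v vS1 vmin] := exists_min_deg e1 S10.
pose n0 := deg e1 v.
have n0d : d < n0.
  have := E3 S11 v vS1; move: F1 S11; rewrite -/n0; case: #|S1| => //= m; clear; nia.
have [esym1 eirr1 eS1] := g1.
have n02d : n0 <= 2 * d.
  have /card_gt0P[y] : 0 < deg e1 v by move: n0d; rewrite -/n0; clear; lia.
  rewrite inE => vy; have := E1 _ _ vy; move: vmin S11; rewrite -/n0; clear; nia.
have cod u : u \in nbh e1 v -> d <= #|nbh e1 u :&: nbh e1 v|.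
  rewrite inE esym1 => uv; have := E2 S11 _ _ uv; move: F1 S11.
  by case: #|S1| => //= m; clear; nia.
pose A1 := nbh e1 v.
have g1' : graph_on A1 (induced e1 A1) by exact: neighbourhood_graph g1 _.
have cA1 : #|A1| = n0 by [].
have A10 : 0 < #|A1| by rewrite cA1; exact: leq_ltn_trans n0d.
have F1' : #|A1| * (#|A1| + n0) <= 4 * #|darts (induced e1 A1)|.
  have : #|A1| * d <= #|darts (induced e1 A1)|.
    rewrite -sum_nat_const card_darts_all [X in X <= _]big_mkcond; apply: leq_sum => u _.
    by case: ifP => // uA; rewrite /deg (nbh_induced e1) // cod.
  by rewrite cA1; move: n02d; clear; nia.
have [S2 [e2 [g2 m2 S20 F2 [G1 G2 G3]]]] :=
  minimal_minor (F := fun n => n * (n + n0)) g1' A10 F1'.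
have [esym2 eirr2 eS2] := g2.
have n3 : n0 + 4 <= 3 * #|S2|.
  have := card_darts_le g2; move: F2 S20 n0d d1; case: #|S2| => [|m] //=; clear; nia.
have n24 : 24 <= #|S2| by move: n3 n0d d1; clear; lia.
have S21 : 1 < #|S2| by move: n24; clear; lia.
have [w wS2 wmin] := exists_min_deg e2 S20.
pose n1 := deg e2 w.
have n10 : 0 < n1.
  have := G3 S21 w wS2; move: F2 S21; rewrite -/n1; case: #|S2| => //= m; clear; nia.
have [y wy] : exists y, e2 w y by case/card_gt0P: (n10) => y; rewrite inE; exists y.
have n1le : 4 * n1 <= #|S2| + n0.
  have := G1 _ _ wy; move: wmin n24; rewrite -/n1; clear; nia.
pose A2 := nbh e2 w.
have cod2 u : u \in A2 -> 2 * #|S2| + n0 <= 8 * #|nbh e2 u :&: A2| + 8.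
  rewrite /A2 inE esym2 => uw; have := G2 S21 _ _ uw; move: F2 S21.
  by case: #|S2| => //= m; clear; nia.
have cA2 : #|A2| = n1 by [].
have [isym iirr iS] : graph_on A2 (induced e2 A2) by exact: neighbourhood_graph g2 _.
have K : has_K_minor (induced e2 A2) k.
  apply: (@dense_minor T (induced e2 A2) A2 s k) => //; last 1 first.
  - have := cod2 y; rewrite inE => /(_ wy).
    have := subset_leq_card (subsetIr (nbh e2 y) A2); rewrite cA2.
    by move: n3 n0d sk0; rewrite /d; clear; lia.
  - move=> x xA; rewrite /deg (nbh_induced e2) // cA2.
    by have := cod2 x xA; move: n1le n24; clear; lia.
  - move=> x x' xA xA'; rewrite !(nbh_induced e2) //.
    have h1 := cod2 x xA; have h2 := cod2 x' xA'.
    have := cardsUI (nbh e2 x :&: A2) (nbh e2 x' :&: A2).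
    have : #|(nbh e2 x :&: A2) :|: (nbh e2 x' :&: A2)| <= n1.
      by rewrite -cA2; apply: subset_leq_card; rewrite subUset !subsetIr.
    by rewrite cA2; move: h1 h2 n1le n24 n3; clear; lia.
  - by move: k1; clear; lia.
have sub (f : rel T) A x y' : induced f A x y' -> f x y' by case/and3P.
apply: (m1 k k1); apply: (minor_subrel (@sub e1 A1) k1).
by apply: (m2 k k1); apply: (minor_subrel (@sub e2 A2) k1).
Qed.

Lemma girth_upper_bound (T : finType) (e : rel T) k p g r s :
  simple_graph e -> K_minor_free e k -> girth_ge e g -> ~ p_path_degenerate e p ->
  2 <= p -> 1 < k -> 0 < s -> k <= 2 ^ (s * s) -> 2 ^ 16 * (s * k) <= 2 ^ r ->
  g <= (4 * r + 2) * p.-1.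
Proof.
move=> sg free gth nd p2 k1 s0 ks rb; rewrite leqNgt; apply/negP => gr.
have r16 : 16 <= r.
  rewrite -(leq_exp2l (m := 2)) //; apply: leq_trans rb.
  by rewrite leq_pmulr // muln_gt0 s0 ltnW.
apply: (irreducible_core p2 nd) => S Sn0 irr.
have g3 : 3 * p.-1 < g.
  by apply: leq_ltn_trans gr; rewrite leq_mul2r; apply/orP; right; move: r16; clear; lia.
have [e' [h1 h2 h3 h4 [h5 h6]]] := core_minor sg gth p2 g3 Sn0 irr.
(* An edge of [e'] stands for at most [p.-1] original edges. *)
have gth' : girth_ge e' (4 * r + 3).
  move=> c u sz cyc; have := leq_trans gr (h6 c u sz cyc).
  by rewrite ltn_mul2r => /andP[_]; rewrite addn3 addn2.
have [X [e2 [q1 q2 q3 q4 [X0 q5]]]] := dense_quotient h1 h2 h5 h4 gth' (r := r) ltac:(by rewrite addn2 addn3).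
apply: free; apply: (h3 k k1); apply: (q3 k k1).
apply: (@average_degree_minor T X e2 s k) => //.
(* [2 ^ 16] exceeds [26 * 2200]: the loss in the quotient times the density that forces the
   minor. *)
have : 2 ^ 16 * (s * k) * #|X| <= 26 * #|darts e2|.
  by apply: leq_trans q5; rewrite leq_mul2r rb orbT.
have -> : 2 ^ 16 = 256 * 256 by rewrite (expnD 2 8 8).
by rewrite -!mulnA; move: (s * (k * _)) => q; clear; lia.
Qed.

(** * Subdivisions of cubic graphs *)

Section Subcubic.
Variables (T : finType) (e : rel T).
Hypotheses (esym : symmetric e) (eirr : irreflexive e).

(** A spanning tree is grown vertex by vertex, each new vertex bringing two darts. *)
Lemma connected_darts (B : {set T}) : B != set0 -> connected_in e B ->
  2 * #|B|.-1 <= #|darts (induced e B)|.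
Proof.
case/set0Pn => b bB conn.
have grow j : j < #|B| -> exists A : {set T},
    [/\ A \subset B, #|A| = j.+1, b \in A & 2 * j <= #|darts (induced e A)|].
  elim: j => [|j IH] jB; first by exists [set b]; rewrite sub1set bB cards1 inE eqxx.
  have [A [AB cA bA dA]] := IH (ltnW jB).
  have [y yB yA] : exists2 y, y \in B & y \notin A.
    apply/subsetPn; apply/negP => /subset_leq_card; rewrite cA leqNgt.
    by rewrite jB.
  have [x [w [xA wB wA exw]]] : exists x w, [/\ x \in A, w \in B, w \notin A & e x w].
    case P : [exists x, exists w, [&& x \in A, w \in B, w \notin A & e x w]].
      by have /existsP[x /existsP[w /and4P[]]] := P; exists x, w.
    move: yA; have -> // : y \in A.
    apply: (connect_path_ind (P := fun u => u \in A) (conn b y bB yB)) => //.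
    move=> u v uA /and3P[_ vB euv]; apply/negPn/negP => vA.
    move/negbT: P; rewrite negb_exists => /forallP/(_ u); rewrite negb_exists => /forallP/(_ v).
    by rewrite uA vB vA euv.
  exists (w |: A); split.
  - by rewrite subUset sub1set wB.
  - by rewrite cardsU1 wA cA.
  - by rewrite inE bA orbT.
  have xw : x != w by apply: contraTneq xA => ->.
  have sub : darts (induced e A) :|: [set (x, w); (w, x)] \subset darts (induced e (w |: A)).
    apply/subsetP => -[u v]; rewrite !inE /induced /= !inE.
    case/or3P => [/and3P[-> -> ->]|/eqP[-> ->]|/eqP[-> ->]]; rewrite ?orbT //.
      by rewrite eqxx xA exw orbT.
    by rewrite eqxx xA esym exw orbT.
  apply: leq_trans (subset_leq_card sub).
  rewrite cardsU cards2 xpair_eqE (negPf xw) /=.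
  have -> : darts (induced e A) :&: [set (x, w); (w, x)] = set0.
    apply/setP => -[u v]; rewrite !inE /induced /=; apply/negbTE/negP => /andP[/and3P[uA vA _]].
    by case/orP => /eqP[Eu Ev]; move: wA; rewrite -?Eu -?Ev ?uA ?vA.
  by rewrite cards0 subn0 mulnS addnC leq_add2r.
have B0 : 0 < #|B| by apply/card_gt0P; exists b.
have [A [AB cA _ dA]] := grow #|B|.-1 ltac:(by rewrite prednK).
suff -> : B = A by rewrite cA.
by apply/eqP; rewrite eq_sym eqEcard AB cA prednK ?leqnn.
Qed.

(** A branch set [B] has at least [2 * #|B|.-1] inner darts and [k.-1] leaving ones, but its degree
    sum is at most [2 * #|B|] plus its number of cubic vertices. So each of the [k] disjoint branch
    sets contains at least [k - 3] cubic vertices. *)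
Lemma subcubic_minor_free k : (forall x, deg e x <= 3) ->
  #|[set x | deg e x == 3]| < k * (k - 3) -> K_minor_free e k.
Proof.
move=> d3; set D3 := [set x | _] => lt [B [Bn0 Bd Bc Be]].
have branch i : k <= #|B i :&: D3| + 3.
  pose Do := [set d in darts e | (d.1 \in B i) && (d.2 \notin B i)].
  have out : k.-1 <= #|Do|.
    pose h (d : T * T) := [pick j | d.2 \in B j].
    apply: leq_trans (leq_imset_card h _).
    have -> : k.-1 = #|[set Some j | j in ~: [set i]]|.
      by rewrite card_imset; [rewrite cardsC1 card_ord | move=> ? ? []].
    apply: subset_leq_card; apply/subsetP => _ /imsetP[j ji ->].
    have nij : i != j by move: ji; rewrite !inE eq_sym.
    have [x [y [xi yj exy]]] := Be i j nij.
    apply/imsetP; exists (x, y).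
      by rewrite !inE exy xi /= (disjointFl (Bd i j nij) yj).
    rewrite /h /=; case: pickP => [j' yj'|/(_ j)]; last by rewrite yj.
    have [->//|nj] := eqVneq j j'.
    by rewrite (disjointFl (Bd j j' nj) yj') in yj.
  have tot : #|darts (induced e (B i))| + #|Do| <= \sum_(x in B i) deg e x.
    rewrite -card_darts -[X in _ <= X](cardsID [set d | d.2 \in B i]); apply: leq_add.
      apply: subset_leq_card; apply/subsetP => -[x y]; rewrite !inE /induced /=.
      by case/and3P => -> -> ->.
    apply: subset_leq_card; apply/subsetP => -[x y]; rewrite !inE /=.
    by case/and3P => -> -> ->.
  have up : \sum_(x in B i) deg e x <= 2 * #|B i| + #|B i :&: D3|.
    have -> : #|B i :&: D3| = \sum_(x in B i | x \in D3) 1.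
      by rewrite -sum1_card; apply: eq_bigl => x; rewrite in_setI.
    rewrite mulnC -sum_nat_const.
    rewrite [X in _ <= _ + X]big_mkcondr -big_split /=; apply: leq_sum => x _.
    by rewrite inE; have := d3 x; case: (deg e x) => [|[|[|[|]]]].
  have := connected_darts (Bn0 i) (Bc i).
  have : 0 < #|B i| by rewrite card_gt0.
  by move: out tot up; clear; lia.
have : \sum_(i < k) #|B i :&: D3| <= #|D3|.
  have -> : \sum_(i < k) #|B i :&: D3| = \sum_(x in D3) #|[set i | x \in B i]|.
    rewrite (eq_bigr (fun i => \sum_(x in B i :&: D3) 1)); last by move=> i _; rewrite sum1_card.
    rewrite (exchange_big_dep (mem D3)) /=; last by move=> i x _; rewrite inE => /andP[].
    apply: eq_bigr => x xD; rewrite sum1_card; apply: eq_card => i.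
    by change ((x \in B i :&: D3) = (i \in [set i0 | x \in B i0])); rewrite in_setI xD andbT inE.
  rewrite -sum1_card; apply: leq_sum => x _; apply/card_le1P => i.
  rewrite inE => xi j; rewrite !inE; apply/idP/eqP => [xj|->//].
  by apply/eqP; apply/negPn/negP => nij; rewrite (disjointFl (Bd _ _ nij) xi) in xj.
rewrite leqNgt => /negP; apply; apply: leq_trans lt _.
rewrite -[X in X * _]card_ord -sum_nat_const; apply: leq_sum => i _.
by rewrite leq_subLR addnC.
Qed.

End Subcubic.

Lemma uniq_path_nbwalk (T : finType) (e : rel T) x s :
  path.path e x s -> uniq (x :: s) -> nbwalk e (x :: s).
Proof.
elim: s x => // y s IH x /andP[exy ps] /andP[xs us].
apply/and3P; split => //; last exact: IH.
by case: (s) xs => // z t; rewrite !inE !negb_or => /and3P[].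
Qed.

Lemma cycle_nbwalk (T : finType) (e : rel T) x s :
  path.cycle e (x :: s) -> uniq (x :: s) -> 2 <= size s -> nbwalk e (x :: rcons s x).
Proof.
case/lastP: s => [|s v] //; case/lastP: s => [|t u] // cyc un _.
have h1 : nbwalk e (x :: rcons (rcons t u) v).
  by apply: uniq_path_nbwalk => //; move: cyc; rewrite /= path.rcons_path => /andP[].
have -> : x :: rcons (rcons (rcons t u) v) x = (x :: t) ++ [:: u, v & [:: x]].
  by rewrite -!cats1 -!catA.
apply: nbwalk_join; first by move: h1; rewrite -!cats1 -catA.
have euv : e u v by move: cyc; rewrite /= !path.rcons_path !last_rcons => /andP[/andP[]].
have evx : e v x by move: cyc; rewrite /= path.rcons_path last_rcons => /andP[].
have : x \notin rcons (rcons t u) v by case/andP: un.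
rewrite mem_rcons inE mem_rcons inE !negb_or => /and3P[_ xu _].
by rewrite /= euv evx eq_sym xu.
Qed.

(** * Subdivision of an edge-coloured bipartite graph *)

Section Subdivision.
Variables (A : finType) (pi : 'I_3 -> A -> A) (n : nat).
Hypothesis piK : forall i, involutive (pi i).

(* Every edge of the coloured bipartite graph becomes a path of length n.+1. *)
Definition subdiv_vertex : finType := ((A * bool) + (A * 'I_3 * 'I_n))%type.

(** Index 0 is the left end, indices 1 to [n] are the inner vertices; beyond [n] the call to [insub]
    fails and yields the right end. *)
Definition node a i j : subdiv_vertex :=
  if j is j'.+1 then
    if insub j' is Some o then inr (a, i, o) else inl (pi i a, true)
  else inl (a, false).

Definition subdiv : rel subdiv_vertex := fun x y =>
  [exists a, exists i, exists j : 'I_n.+1,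
    (x == node a i j) && (y == node a i j.+1) || (y == node a i j) && (x == node a i j.+1)].

Lemma node_inner a i j (h : j < n) : node a i j.+1 = inr (a, i, Ordinal h).
Proof. by rewrite /node insubT. Qed.

Lemma node_end a i : node a i n.+1 = inl (pi i a, true).
Proof. by rewrite /node insubF // ltnn. Qed.

Lemma node_inner_inj a i j a' i' j' : j < n -> j' <= n.+1 ->
  node a i j.+1 = node a' i' j' -> [/\ a' = a, i' = i & j' = j.+1].
Proof.
move=> h; case: j' => [|j']; rewrite (node_inner _ _ h) // ltnS leq_eqVlt.
case/orP => [/eqP->|h']; first by rewrite node_end.
by rewrite (node_inner _ _ h') => -[-> -> ->].
Qed.

Lemma node_false a i j b : j <= n.+1 -> node a i j = inl (b, false) -> j = 0 /\ a = b.
Proof.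
case: j => [|j]; first by move=> _ [].
rewrite ltnS leq_eqVlt => /orP[/eqP->|h]; first by rewrite node_end.
by rewrite (node_inner _ _ h).
Qed.

Lemma node_true a i j b : j <= n.+1 -> node a i j = inl (b, true) -> j = n.+1 /\ a = pi i b.
Proof.
case: j => [|j] //.
rewrite ltnS leq_eqVlt => /orP[/eqP->|h]; last by rewrite (node_inner _ _ h).
by rewrite node_end => -[<-]; rewrite piK.
Qed.

Lemma subdiv_sym : symmetric subdiv.
Proof.
by move=> x y; apply: eq_existsb => a; apply: eq_existsb => i; apply: eq_existsb => j; rewrite orbC.
Qed.

Lemma subdivP x y : reflect (exists a i j, j <= n /\
   (x = node a i j /\ y = node a i j.+1 \/ y = node a i j /\ x = node a i j.+1)) (subdiv x y).
Proof.
apply: (iffP existsP) => [[a /existsP[i /existsP[j /orP[] /andP[/eqP-> /eqP->]]]]|].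
- by exists a, i, j; split; [rewrite -ltnS | left].
- by exists a, i, j; split; [rewrite -ltnS | right].
move=> [a [i [j [jn h]]]]; exists a; apply/existsP; exists i; apply/existsP.
exists (Ordinal (jn : j < n.+1)) => /=.
by case: h => -[-> ->]; rewrite !eqxx ?orbT.
Qed.

(* [dnode sd a i j] is the j-th vertex on the path of colour [i] that leaves the vertex [a] of side [sd]. *)
Definition dnode (sd : bool) a i j := if sd then node (pi i a) i (n.+1 - j) else node a i j.

Lemma dnode0 sd a i : dnode sd a i 0 = inl (a, sd).
Proof. by case: sd; rewrite /dnode ?subn0 ?node_end ?piK. Qed.

Lemma dnode_end sd a i : dnode sd a i n.+1 = inl (pi i a, ~~ sd).
Proof. by case: sd; rewrite /dnode ?subnn // node_end. Qed.

Lemma dnode1 sd a i : n = 0 -> dnode sd a i 1 = inl (pi i a, ~~ sd).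
Proof. by move=> n0; rewrite -dnode_end; congr (dnode sd a i _); rewrite n0. Qed.

Lemma dnode_rev sd a i j : j <= n.+1 -> dnode (~~ sd) (pi i a) i j = dnode sd a i (n.+1 - j).
Proof. by case: sd => jn; rewrite /dnode /= ?piK // subKn. Qed.

Lemma subdiv_dnode sd a i j : j <= n -> subdiv (dnode sd a i j) (dnode sd a i j.+1).
Proof.
move=> jn; apply/subdivP; case: sd => /=.
  exists (pi i a), i, (n - j); rewrite leq_subr subSS; split=> //; right.
  by rewrite subSn.
by exists a, i, j; split=> //; left.
Qed.

Lemma nbh_branch sd a y : subdiv (inl (a, sd)) y -> exists i, y = dnode sd a i 1.
Proof.
case/subdivP => b [i [j [jn h]]]; exists i; case: sd h => -[[E ->]|[-> E]].
- by have [] := node_true (leqW jn) (esym E); lia.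
- have [/succn_inj Ej Eb] := node_true (jn : j.+1 <= n.+1) (esym E).
  by rewrite /dnode subSS subn0 Ej Eb.
- by have [-> ->] := node_false (leqW jn) (esym E).
- by have [] := node_false (jn : j.+1 <= n.+1) (esym E).
Qed.

Lemma nbh_inner sd a i j y : j < n -> subdiv (dnode sd a i j.+1) y ->
  y = dnode sd a i j \/ y = dnode sd a i j.+2.
Proof.
have main b i' j' y' : j' < n -> subdiv (node b i' j'.+1) y' -> y' = node b i' j' \/ y' = node b i' j'.+2.
  move=> jn /subdivP[c [k [l [ln [[E ->]|[-> E]]]]]].
    by have [-> -> ->] := node_inner_inj jn (leqW ln) E; right.
  by have [-> -> [->]] := node_inner_inj jn (ln : l.+1 <= n.+1) E; left.
move=> jn; case: sd => /=; last exact: main.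
rewrite !subSS; have -> : n - j = (n - j.+1).+1 by lia.
move=> /main h; case: h; first by lia.
  by move=> ->; right; congr node; lia.
by move=> ->; left; congr node; lia.
Qed.

Lemma dnode_inner sd a i j : 0 < j <= n -> exists t, dnode sd a i j = inr t.
Proof.
case: sd; case: j => // j jn; rewrite /dnode.
  have h : n - j.+1 < n by lia.
  by rewrite subSS (_ : n - j = (n - j.+1).+1); [rewrite (node_inner _ _ h); eexists|lia].
by rewrite (node_inner _ _ jn); eexists.
Qed.

(** Inside a subdivided edge the walk must go on, and at its end it must change colour. So it spells
    a word [i :: c] without equal neighbours; each letter takes [n.+1] steps, applies [pi] and
    changes sides. Starting at position [j] makes the induction work. *)
Lemma peel sd a i j s b sd' : j <= n ->
  nbwalk subdiv (dnode sd a i j :: dnode sd a i j.+1 :: s) ->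
  last (dnode sd a i j.+1) s = inl (b, sd') ->
  exists c, [/\ path.sorted (fun i j : 'I_3 => i != j) (i :: c),
    size s + j.+1 = n.+1 * (size c).+1, foldl (fun v i => pi i v) a (i :: c) = b
    & sd' = sd (+) odd (size c).+1].
Proof.
elim: s sd a i j => [|y s IH] sd a i j jn.
  move=> _ /=; move: (jn); rewrite leq_eqVlt => /orP[/eqP->|jn'].
    rewrite dnode_end => -[<- <-]; exists [::]; split => //; last by rewrite addbT.
    by rewrite muln1.
  by have [t ->] := dnode_inner sd a i (jn' : 0 < j.+1 <= n).
case/and3P => _ ne nb; rewrite [last _ _]/= => Es.
have ey : subdiv (dnode sd a i j.+1) y by case/andP: nb.
move: (jn); rewrite leq_eqVlt => /orP[/eqP Ej|jn'].
  have Ed : dnode sd a i j.+1 = dnode (~~ sd) (pi i a) i 0 by rewrite Ej dnode_end dnode0.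
  have [i' Ey] : exists i', y = dnode (~~ sd) (pi i a) i' 1.
    by apply: nbh_branch; move: ey; rewrite Ed dnode0.
  have ii' : i != i'.
    apply: contra ne => /eqP Ei; rewrite Ey -Ei dnode_rev //.
    by rewrite subSS subn0 Ej.
  have [] := IH (~~ sd) (pi i a) i' 0 (leq0n _) _ _.
  - by move: nb; rewrite Ed Ey !dnode0.
  - by rewrite -Ey.
  move=> c [c1 c2 c3 c4]; exists (i' :: c); split.
  - by rewrite /= ii'.
  - by rewrite [in RHS]mulnS -c2 Ej addn1 addnC.
  - by rewrite -c3.
  - by rewrite c4 /=; case: (sd); case: (odd _).
have [Ey|Ey] := nbh_inner jn' ey; first by rewrite Ey eqxx in ne.
have [] := IH sd a i j.+1 jn' _ _.
- by rewrite -Ey.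
- by rewrite -Ey.
by move=> c [c1 c2 c3 c4]; exists c; split => //; rewrite -c2 /=; lia.
Qed.

Variable N0 : nat.
Hypothesis closed_walk : forall c a, path.sorted (fun i j : 'I_3 => i != j) c -> 0 < size c ->
  ~~ odd (size c) -> foldl (fun v i => pi i v) a c = a -> N0 <= size c.

Lemma subdiv_girth : girth_ge subdiv (N0 * n.+1).
Proof.
move=> s us sz cyc.
(* Without branch vertices, the vertex of largest position on the cycle would have its predecessor
   on the path as both of its cycle neighbours. *)
have [[a sd] hb] : exists v : A * bool, inl v \in s.
  have [x0 x0s] : exists x, x \in s by case: (s) sz => // x t _; exists x; rewrite mem_head.
  pose pos (x : subdiv_vertex) : nat := if x is inr (_, _, o) then o else 0.
  pose x := [arg max_(x > x0 in s) pos x].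
  have [xs xmax] : x \in s /\ forall y, y \in s -> pos y <= pos x.
    by rewrite /x; case: arg_maxnP.
  have [k t Er] := rot_to xs.
  have cyc' : path.cycle subdiv (x :: t) by rewrite -Er path.rot_cycle.
  have us' : uniq (x :: t) by rewrite -Er rot_uniq.
  have sz' : 3 <= size (x :: t) by rewrite -Er size_rot.
  have mem' y : y \in x :: t -> y \in s by rewrite -Er mem_rot.
  case Ex : x => [v|[[a i] o]]; first by exists v; rewrite -Ex.
  have Exn : x = node a i o.+1 by rewrite Ex (node_inner _ _ (ltn_ord o)); congr inr; congr (_, _); apply: val_inj.
  have nxt y : subdiv x y -> y \in s -> y = node a i o \/ exists v : A * bool, inl v \in s.
    move=> exy ys; rewrite Exn in exy.
    have [->|Ey] := nbh_inner (sd := false) (ltn_ord o) exy; [by left | right].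
    move: Ey; rewrite /dnode; have := ltn_ord o; rewrite leq_eqVlt => /orP[/eqP on|h].
      by rewrite on node_end => Ey; exists (pi i a, true); rewrite -Ey.
    rewrite (node_inner _ _ h) => Ey; have := xmax y ys.
    by rewrite Ey Ex /= ltnn.
  case: (t) cyc' us' sz' mem' => [|y [|z t']] // cyc' us' _ mem'.
  have e1 : subdiv x y by move: cyc' => /= /andP[].
  have e2 : subdiv x (last z t').
    by rewrite subdiv_sym; move: cyc'; rewrite /= path.rcons_path => /and4P[].
  have m1 : y \in s by apply: mem'; rewrite !inE eqxx orbT.
  have m2 : last z t' \in s by apply: mem'; rewrite in_cons in_cons mem_last !orbT.
  have [Ey|//] := nxt y e1 m1; have [Ez|//] := nxt _ e2 m2.
  by case/and3P: us' => _ + _; rewrite Ey -Ez mem_last.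
have [k t Er] := rot_to hb.
have cyc' : path.cycle subdiv (inl (a, sd) :: t) by rewrite -Er path.rot_cycle.
have us' : uniq (inl (a, sd) :: t) by rewrite -Er rot_uniq.
have Esz : size s = (size t).+1 by rewrite -(size_rot k) Er.
have nb : nbwalk subdiv (inl (a, sd) :: rcons t (inl (a, sd))).
  by apply: cycle_nbwalk => //; move: sz; rewrite Esz.
case: t Er cyc' us' Esz nb => [|y t] Er cyc' us' Esz nb; first by move: sz; rewrite Esz.
have [i Ey] : exists i, y = dnode sd a i 1.
  by apply: nbh_branch; move: cyc' => /= /andP[].
have [] := @peel sd a i 0 (rcons t (inl (a, sd))) a sd (leq0n _).
- by rewrite dnode0 -Ey.
- by rewrite last_rcons.
move=> c [c1 c2 c3 c4].
have N0c : N0 <= (size c).+1.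
  apply: (closed_walk (c := i :: c) (a := a)) => //.
  by move: c4; rewrite /=; case: (sd); case: (odd _).
apply: leq_trans (eq_leq (esym Esz)); move: c2; rewrite size_rcons addn1 => ->.
by rewrite mulnC leq_mul2l N0c orbT.
Qed.

Hypothesis N3 : 2 < N0.

Lemma colours_distinct a i j : pi i a = pi j a -> i = j.
Proof.
move=> E; apply/eqP/negPn/negP => ij.
have := @closed_walk [:: i; j] a; rewrite /= ij E piK => /(_ isT isT isT erefl).
by rewrite leqNgt N3.
Qed.

Lemma deg_branch a sd : deg subdiv (inl (a, sd)) = 3.
Proof.
have -> : deg subdiv (inl (a, sd)) = #|[set dnode sd a i 1 | i : 'I_3]|.
  apply: eq_card => y; rewrite inE; apply/idP/imsetP => [/nbh_branch[i ->]|[i _ ->]].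
    by exists i.
  by rewrite -(dnode0 sd a i); apply: subdiv_dnode.
rewrite card_imset ?card_ord // => i j.
have [n0|n0] := posnP n.
  by rewrite !dnode1 // => -[/colours_distinct].
case: sd; rewrite /dnode; last by rewrite !(node_inner _ _ n0) => -[].
have n1 : n.-1 < n by rewrite prednK.
have En b l : node b l n = inr (b, l, Ordinal n1) by rewrite -(node_inner b l n1) prednK.
by rewrite subSS subn0 !En => -[].
Qed.

Lemma deg_subdivided t : deg subdiv (inr t) = 2.
Proof.
case: t => [[a i] o].
have -> : inr (a, i, o) = dnode false a i o.+1.
  by rewrite /dnode (node_inner _ _ (ltn_ord o)); congr inr; congr (_, _); apply: val_inj.
have -> : deg subdiv (dnode false a i o.+1) = #|[set dnode false a i o; dnode false a i o.+2]|.
  apply: eq_card => y; rewrite !inE; apply/idP/orP => [/(nbh_inner (ltn_ord o))[]->|[]/eqP->].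
  - by left.
  - by right.
  - by rewrite subdiv_sym; apply: subdiv_dnode; apply: ltnW.
  - exact: subdiv_dnode.
rewrite cards2; suff -> : dnode false a i o != dnode false a i o.+2 by [].
apply/eqP; rewrite /dnode; have := ltn_ord o; case: (nat_of_ord o) => [|j] jn.
  by move=> /esym/(node_false (jn : 2 <= n.+1)) [].
by case/(node_inner_inj (ltnW jn) (jn : j.+3 <= n.+1)) => _ _; lia.
Qed.

Lemma subdiv_irr : irreflexive subdiv.
Proof.
move=> [[a sd]|t]; apply/negbTE/negP.
  move=> /nbh_branch[i]; rewrite -{1}(dnode0 sd a i); have [n0|n0] := posnP n.
    by rewrite dnode1 // dnode0; case: sd.
  by have [t ->] := dnode_inner sd a i (n0 : 0 < 1 <= n); rewrite dnode0.
case: t => [[a i] o].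
have -> : inr (a, i, o) = dnode false a i o.+1.
  by rewrite /dnode (node_inner _ _ (ltn_ord o)); congr inr; congr (_, _); apply: val_inj.
move=> /(nbh_inner (ltn_ord o)) [] /=.
  by case/(node_inner_inj (ltn_ord o) (ltnW (leqW (ltn_ord o)))) => _ _; lia.
by case/(node_inner_inj (ltn_ord o) (ltn_ord o : o.+2 <= n.+1)) => _ _; lia.
Qed.

Lemma deg_in_setT x : deg_in subdiv setT x = deg subdiv x.
Proof. by apply: eq_card => y; rewrite !inE. Qed.

(** No reduction applies to the whole graph: all degrees are 2 or 3, and the internal vertices of an
    ear, having degree two, lie on a single subdivided edge, so the ear has length at most
    [n.+1]. *)
Lemma subdiv_not_degenerate : 0 < #|A| -> ~ p_path_degenerate subdiv n.+2.
Proof.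
case/card_gt0P => a0 _; rewrite /p_path_degenerate => red.
have no S' : ~ p_reduction subdiv n.+2 setT S'.
  case=> [x _|x _|x mid y pt un xy al sz].
  - by rewrite deg_in_setT; case: x => [[a sd]|t]; rewrite ?deg_branch ?deg_subdivided.
  - by rewrite deg_in_setT; case: x => [[a sd]|t]; rewrite ?deg_branch ?deg_subdivided.
  have inn z : z \in mid -> exists t, z = inr t.
    move/allP: al => al /al; rewrite deg_in_setT.
    by case: z => [[a sd]|t]; rewrite ?deg_branch // => _; exists t.
  case: mid pt un al sz inn => [|z mid] pt un _ sz inn; first by move: sz.
  have [[[a i] o0] Ez] := inn z (mem_head _ _).
  pose fib := [set (inr (a, i, o) : subdiv_vertex) | o : 'I_n].
  have sub : {subset z :: mid <= fib}.
    have zf : z \in fib by rewrite Ez; apply/imsetP; exists o0.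
    move: pt; rewrite /= => /andP[_]; move: inn zf; clear.
    elim: mid z => [|w mid IH] z inn zf; first by move=> _ u; rewrite inE => /eqP->.
    rewrite /= => /andP[/and3P[_ _ ezw] pm].
    have wf : w \in fib.
      move: ezw; have [t Ew] : exists t, w = inr t by apply: inn; rewrite !inE eqxx orbT.
      case/imsetP: zf => o _ ->.
      have -> : inr (a, i, o) = dnode false a i o.+1.
        by rewrite /dnode (node_inner _ _ (ltn_ord o)); congr inr; congr (_, _); apply: val_inj.
      case/(nbh_inner (ltn_ord o)); rewrite /dnode => Hw; rewrite Hw in Ew *; move: Ew.
        case Eo : (nat_of_ord o) => [|j] // _.
        have jn : j < n by apply: ltnW; rewrite -Eo.
        by rewrite (node_inner _ _ jn); apply/imsetP; eexists.
      have := ltn_ord o; rewrite leq_eqVlt => /orP[/eqP->|h]; first by rewrite node_end.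
      by rewrite (node_inner _ _ h) => _; apply/imsetP; eexists.
    have inn' u : u \in w :: mid -> exists t, u = inr t.
      by move=> hu; apply: inn; rewrite inE hu orbT.
    have sub := IH w inn' wf pm.
    by move=> u; rewrite inE => /predU1P[->|/sub].
  have um : uniq (z :: mid).
    by move: un; rewrite cons_uniq rcons_uniq => /and3P[].
  have sub' : {subset z :: mid <= enum fib} by move=> u /sub; rewrite mem_enum.
  have := uniq_leq_size um sub'.
  rewrite -cardE => h; have := leq_trans h (leq_imset_card _ _).
  by rewrite card_ord; move: sz => /=; lia.
case: {-2}_ / red (erefl [set: subdiv_vertex]) => [/setP/(_ (inl (a0, true)))|S S' r _ E].
  by rewrite !inE.
by apply: (no S'); rewrite -E.
Qed.

Lemma subdiv_minor_free k : 2 * #|A| < k * (k - 3) -> K_minor_free subdiv k.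
Proof.
move=> lt; apply: subcubic_minor_free subdiv_sym _ _ _.
  by case=> [[a sd]|t]; rewrite ?deg_branch ?deg_subdivided.
apply: leq_ltn_trans lt; have -> : 2 * #|A| = #|{: A * bool}| by rewrite card_prod card_bool mulnC.
rewrite -(card_imset predT (@inl_inj (A * bool) (A * 'I_3 * 'I_n))).
apply: subset_leq_card; apply/subsetP => -[v|t]; rewrite inE.
  by move=> _; apply/imsetP; exists v.
by rewrite deg_subdivided.
Qed.

End Subdivision.

(** Edges become paths of length [p.-1], the longest that still escape a [p]-reduction. *)
Lemma gset_subdivision (A : finType) (pi : 'I_3 -> A -> A) N0 k p :
  (forall i, involutive (pi i)) ->
  (forall c a, path.sorted (fun i j : 'I_3 => i != j) c -> 0 < size c ->
     ~~ odd (size c) -> foldl (fun v i => pi i v) a c = a -> N0 <= size c) ->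
  0 < #|A| -> 2 < N0 -> 2 * #|A| < k * (k - 3) -> 2 <= p -> gset k p (N0 * p.-1).
Proof.
move=> piK cw A0 N3 lt; case: p => [|[|n]] // _.
exists (subdiv_vertex A n), (@subdiv A pi n); split.
- by split; [exact: subdiv_sym | exact: subdiv_irr].
- exact: subdiv_minor_free cw N3 _ lt.
- exact: subdiv_girth.
- exact: subdiv_not_degenerate cw N3 A0.
Qed.

(** * A cubic graph of large girth *)

From mathcomp Require Import all_fingroup all_algebra all_solvable all_field.
From mathcomp Require Import ring.

Section CubicGraph.
Import GRing.Theory.
Local Open Scope ring_scope.

(* A generator [z] of the multiplicative group has minimal polynomial [g] of degree at least [D]. *)
Lemma binary_field_evaluation D : (1 < D)%N ->
  exists (F : finFieldType) (phi : {rmorphism {poly 'F_2} -> F}) (g : {poly 'F_2}),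
    [/\ 2%:R = 0 :> F, #|F| = (2 ^ D)%N, phi 'X != 1, (D < size g)%N &
        forall f, (phi f == 0) = (g %| f)].
Proof.
move=> D1; have [F0 ch cF0] := pPrimePowerField (p := 2) (k := D) isT (ltnW D1).
pose F : finFieldType := pPrimeCharType ch.
have cF : #|F| = (2 ^ D)%N := cF0.
have two0 : 2%:R = 0 :> F by have := pcharf0 ch.
have /cyclicP[u Hu] : cyclic [set: {unit F}] by exact: field_unit_group_cyclic.
pose z : F := val u.
have gen (a : F) : a != 0 -> exists i, a = z ^+ i.
  rewrite -unitfE => ua; have : FinRing.unit F ua \in [set: {unit F}] by rewrite inE.
  by rewrite Hu => /cycleP[i /(congr1 val)]; rewrite FinRing.val_unitX /= => ->; exists i.
pose phi : {rmorphism {poly 'F_2} -> F} := horner_alg z.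
have phiX : phi 'X = z by exact: horner_algX.
have z1 : z != 1.
  apply/negP => /eqP z1; have : (#|F| <= #|[set (0%R : F); 1%R]|)%N.
    rewrite -cardsT; apply: subset_leq_card; apply/subsetP => a _; rewrite !inE.
    by have [//|/gen[i ->]] := eqVneq a 0; rewrite z1 expr1n eqxx orbT.
  rewrite cF cards2; apply/negP; rewrite -ltnNge.
  have : (2 ^ 2 <= 2 ^ D)%N by rewrite leq_exp2l.
  by apply: leq_trans; case: (_ != _).
(* Row vectors encode polynomials of bounded size in a finite type, so [P] is decidable and has a
   least witness. *)
pose P n := [exists t : 'rV['F_2]_n, (rVpoly t != 0) && (phi (rVpoly t) == 0)].
have Pf (f : {poly 'F_2}) : f != 0 -> phi f = 0 -> P (size f).
  move=> f0 pf; apply/existsP; exists (poly_rV f).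
  by rewrite poly_rV_K // f0 pf eqxx.
have exP : exists n, P n.
  have c1 : (1 < #|F|)%N by rewrite cF -{1}(expn0 2) ltn_exp2l // ltnW.
  have f0 : 'X^(#|F|) - 'X != 0 :> {poly 'F_2}.
    by rewrite -size_poly_gt0 size_polyDl size_polyXn // size_polyN size_polyX ltnS.
  exists (size ('X^(#|F|) - 'X : {poly 'F_2})); apply: Pf => //.
  by rewrite rmorphB rmorphXn /= [horner_alg z 'X]phiX expf_card subrr.
case: (ex_minnP exP) => n /existsP[t /andP[g0 /eqP pg]] nmin.
pose g := rVpoly t; rewrite -/g in g0 pg.
have sg : (size g <= n)%N by exact: size_poly.
have div f : (phi f == 0) = (g %| f).
  apply/eqP/idP => [pf|/dvdpP[q ->]]; last by rewrite rmorphM /= pg mulr0.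
  apply/negPn/negP => nd.
  have r0 : f %% g != 0 by [].
  have : phi (f %% g) = 0.
    have := congr1 phi (divp_eq f g); rewrite rmorphD rmorphM /= pg mulr0 add0r.
    by rewrite pf.
  move/(Pf _ r0)/nmin; rewrite leqNgt => /negP[].
  by apply: leq_trans sg; rewrite ltn_modp.
exists F, phi, g; split => //; first by rewrite phiX.
(* Powers of [z] exhaust the nonzero elements, so each element is the value of a remainder modulo
   [g]; counting remainders bounds the degree of [g] below. *)
have sur (a : F) : exists h : 'rV['F_2]_((size g).-1), phi (rVpoly h) == a.
  have szm (f : {poly 'F_2}) : (size (f %% g)%R <= (size g).-1)%N.
    by rewrite -ltnS prednK ?size_poly_gt0 // ltn_modp.
  have pm (f : {poly 'F_2}) : phi (f %% g) = phi f.
    by rewrite [in RHS](divp_eq f g) rmorphD rmorphM /= pg mulr0 add0r.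
  have [->|/gen[i ->]] := eqVneq a 0.
    by exists 0; rewrite linear0 rmorph0.
  exists (poly_rV ('X^i %% g)); rewrite poly_rV_K // pm rmorphXn /=.
  by rewrite [horner_alg z 'X]phiX.
have : (#|F| <= 2 ^ (size g).-1)%N.
  have <- : #|{: 'rV['F_2]_((size g).-1)}| = (2 ^ (size g).-1)%N.
    by rewrite card_mx card_Fp // mul1n.
  have inj : injective (fun a => xchoose (sur a)).
    by move=> a b /= E; rewrite -(eqP (xchooseP (sur a))) -(eqP (xchooseP (sur b))) E.
  by rewrite -(card_codom inj); exact: max_card.
rewrite cF leq_exp2l // => h; apply: leq_ltn_trans h _.
by rewrite ltn_predL size_poly_gt0.
Qed.

(** * Quaternions over a commutative ring *)

Section Quaternions.
Variables (R : comNzRingType) (x : R).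

Definition quat : Type := (R * R * R * R)%type.

(* (a0, a1, b0, b1) stands for a + b j with a = a0 + a1 w, b = b0 + b1 w, where w^2 + w + 1 = 0, j^2 = - x and j c = c^bar j. *)
Definition qmul (p q : quat) : quat :=
  let: (a0, a1, b0, b1) := p in let: (c0, c1, d0, d1) := q in
  (a0 * c0 - a1 * c1 - x * (b0 * d0 - b0 * d1 + b1 * d1),
   a0 * c1 + a1 * c0 - a1 * c1 - x * (b1 * d0 - b0 * d1),
   a0 * d0 - a1 * d1 + b0 * c0 - b0 * c1 + b1 * c1,
   a0 * d1 + a1 * d0 - a1 * d1 + b1 * c0 - b0 * c1).

Definition qnorm (p : quat) : R :=
  let: (a0, a1, b0, b1) := p in
  a0 ^+ 2 - a0 * a1 + a1 ^+ 2 + x * (b0 ^+ 2 - b0 * b1 + b1 ^+ 2).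

Definition qconj (p : quat) : quat :=
  let: (a0, a1, b0, b1) := p in (a0 - a1, - a1, - b0, - b1).

Definition qscal (c : R) : quat := (c, 0, 0, 0).

(** Coordinates of the cube roots of unity 1, w and w^2 = - 1 - w. *)
Definition qomega (i : 'I_3) : R * R :=
  match val i with 0 => (1, 0) | 1 => (0, 1) | _ => (-1, -1) end.

Definition qgen (i : 'I_3) : quat := (1, 0, (qomega i).1, (qomega i).2).

Lemma qmulA p q r : qmul p (qmul q r) = qmul (qmul p q) r.
Proof.
case: p => [[[? ?] ?] ?]; case: q => [[[? ?] ?] ?]; case: r => [[[? ?] ?] ?] /=.
by congr (_, _, _, _); ring.
Qed.

Lemma qnormM p q : qnorm (qmul p q) = qnorm p * qnorm q.
Proof. case: p => [[[? ?] ?] ?]; case: q => [[[? ?] ?] ?] /=; ring. Qed.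

Lemma qmulVq p : qmul (qconj p) p = qscal (qnorm p).
Proof. by case: p => [[[? ?] ?] ?] /=; congr (_, _, _, _); ring. Qed.

Lemma qscal1 p : qmul (qscal 1) p = p.
Proof. by case: p => [[[? ?] ?] ?] /=; congr (_, _, _, _); ring. Qed.

Lemma qscalC c p : qmul (qscal c) p = qmul p (qscal c).
Proof. by case: p => [[[? ?] ?] ?] /=; congr (_, _, _, _); ring. Qed.

Lemma qscalM c d : qmul (qscal c) (qscal d) = qscal (c * d).
Proof. by rewrite /qscal /=; congr (_, _, _, _); ring. Qed.

Lemma qnorm_scal c : qnorm (qscal c) = c ^+ 2.
Proof. rewrite /=; ring. Qed.

Lemma qnorm_gen i : qnorm (qgen i) = 1 + x.
Proof. by case: i => [[|[|[|]]]] //= ?; rewrite /qomega /=; ring. Qed.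

(** In characteristic two a generator is its own conjugate, so its square is its norm. *)
Lemma qgen_sq i : 2%:R = 0 :> R -> qmul (qgen i) (qgen i) = qscal (1 + x).
Proof.
move=> two; have opp (a : R) : - a = a.
  by apply/eqP; rewrite eq_sym -addr_eq0 -mulr2n -mulr_natl two mul0r.
have {1}<- : qconj (qgen i) = qgen i by rewrite /qgen /= subr0 !opp.
by rewrite qmulVq qnorm_gen.
Qed.

Definition qword (c : seq 'I_3) : quat := foldl (fun q i => qmul q (qgen i)) (qscal 1) c.

Lemma qword_rcons c i : qword (rcons c i) = qmul (qword c) (qgen i).
Proof. by rewrite /qword -cats1 foldl_cat. Qed.

Lemma qnorm_word c : qnorm (qword c) = (1 + x) ^+ size c.
Proof.
elim/last_ind: c => [|c i IH]; first by rewrite qnorm_scal expr1n.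
by rewrite qword_rcons qnormM IH qnorm_gen size_rcons exprSr.
Qed.

End Quaternions.

Definition qmap (R S : Type) (f : R -> S) (p : R * R * R * R) : S * S * S * S :=
  let: (a0, a1, b0, b1) := p in (f a0, f a1, f b0, f b1).

Section QuatMorphism.
Variables (R S : comNzRingType) (f : {rmorphism R -> S}) (x : R).

Lemma qmap_mul p q : qmap f (qmul x p q) = qmul (f x) (qmap f p) (qmap f q).
Proof.
case: p => [[[? ?] ?] ?]; case: q => [[[? ?] ?] ?] /=.
by rewrite !(rmorphD, rmorphN, rmorphM).
Qed.

Lemma qmap_word c : qmap f (qword x c) = qword (f x) c.
Proof.
elim/last_ind: c => [|c i IH]; first by rewrite /= rmorph1 rmorph0.
rewrite !qword_rcons qmap_mul IH; congr qmul.
by case: i => [[|[|[|]]]] //= ?; rewrite /qgen /qomega /= ?rmorphN rmorph1 rmorph0.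
Qed.

End QuatMorphism.

(** * Words in the quaternion generators *)

Section Words.

Lemma F2_cases (a : 'F_2) : a = 0 \/ a = 1.
Proof. by case: a => [[|[|k]] p]; [left|right|]; try exact: val_inj. Qed.

Let szD (p q : {poly 'F_2}) m : (size p <= m)%N -> (size q <= m)%N -> (size (p + q)%R <= m)%N.
Proof. by move=> h1 h2; apply: leq_trans (size_polyD _ _) _; rewrite geq_max h1. Qed.
Let szN (p : {poly 'F_2}) m : (size p <= m)%N -> (size (- p)%R <= m)%N.
Proof. by rewrite size_polyN. Qed.
Let szX (p : {poly 'F_2}) m : (size p <= m)%N -> (size ('X * p)%R <= m.+1)%N.
Proof.
move=> h; have [->|p0] := eqVneq p 0; first by rewrite mulr0 size_poly0.
by rewrite mulrC size_mulX.
Qed.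

(** The variable enters only through products of two [j]-parts, and generators have constant
    entries, so raising the degree by one takes two letters. *)
Lemma size_word c : let: (a0, a1, b0, b1) := qword ('X : {poly 'F_2}) c in
  [/\ (size a0 <= (size c)./2.+1)%N, (size a1 <= (size c)./2.+1)%N,
      (size b0 <= uphalf (size c))%N & (size b1 <= uphalf (size c))%N].
Proof.
elim/last_ind: c => [|c i]; first by rewrite /= !size_poly0 size_poly1.
rewrite qword_rcons size_rcons; case: (qword _ c) => [[[a0 a1] b0] b1] [h1 h2 h3 h4].
set n := size c in h1 h2 h3 h4 *.
have hn : ((n./2).+1 <= (n.+1)./2.+1)%N by rewrite ltnS half_leq.
have hb : (uphalf n <= uphalf n.+1)%N by rewrite uphalf_leq.
have h1' := leq_trans h1 hn; have h2' := leq_trans h2 hn.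
have h3' := leq_trans h3 hb; have h4' := leq_trans h4 hb.
by case: i => [[|[|[|]]]] //= ?; rewrite /qomega /= !(mulr1, mulr0, mulrN1, subr0, addr0, add0r, sub0r, opprK);
  split; do ?[apply: szD|apply: szN|apply: szX].
Qed.

(** At 1 the generators have norm zero, so an invariant is needed: after a last letter with root w,
    the word is a + b j with b = a w and a nonzero. A next root w' different from w multiplies a by
    1 - w / w', which is nonzero. *)
Lemma word_neq0 i c : path.sorted (fun a b : 'I_3 => a != b) (i :: c) ->
  qword (1 : 'F_2) (i :: c) != (0, 0, 0, 0).
Proof.
have inv c' i' : path.sorted (fun a b : 'I_3 => a != b) (rcons c' i') ->
   let: (a0, a1, b0, b1) := qword (1 : 'F_2) (rcons c' i') in
   let: (w0, w1) := qomega 'F_2 i' in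
   [&& (a0 != 0) || (a1 != 0), b0 == a0 * w0 - a1 * w1 & b1 == a0 * w1 + a1 * w0 - a1 * w1].
  elim/last_ind: c' i' => [|c' j IH] i'.
    by move=> _; case: i' => [[|[|[|]]]] //= ?; rewrite /qword /qomega /=; vm_compute.
  have -> : path.sorted (fun a b : 'I_3 => a != b) (rcons (rcons c' j) i') =
      path.sorted (fun a b : 'I_3 => a != b) (rcons c' j) && (j != i').
    by case: c' {IH} => [|h t] /=; rewrite ?andbT // !path.rcons_path last_rcons.
  case/andP => /IH {}IH; rewrite qword_rcons; move: IH.
  case: (qword _ _) => [[[a0 a1] b0] b1].
  case: j => [[|[|[|]]]] //= ?; case: i' => [[|[|[|]]]] //= ?; rewrite /qomega /= => /and3P[ne /eqP-> /eqP->] _;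
  by move: ne; case: (F2_cases a0) => ->; case: (F2_cases a1) => ->; vm_compute.
move=> so; rewrite lastI in so *; have := inv _ _ so.
case: (qword _ _) => [[[a0 a1] b0] b1]; case: (qomega _ _) => w0 w1 /and3P[ne _ _].
by apply: contraTneq ne => -[-> -> _ _]; rewrite eqxx.
Qed.

(** Infinite descent: constant terms show that ['X] divides [a], and then [c] and [d], because the
    form [c ^+ 2 - c * d + d ^+ 2] has only the trivial zero over ['F_2]. *)
Lemma poly_isotropic_free (a c d : {poly 'F_2}) :
  a ^+ 2 + 'X * (c ^+ 2 - c * d + d ^+ 2) = 0 -> [/\ a = 0, c = 0 & d = 0].
Proof.
have [n] := ubnP (size a + size c + size d); elim: n a c d => // n IH a c d sz E.
have divX (p : {poly 'F_2}) : p.[0] = 0 -> exists q, p = q * 'X.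
  by move=> p0; have /factor_theorem[q ->] : root p 0; [rewrite /root p0 | exists q; rewrite subr0].
have X0 : 'X != 0 :> {poly 'F_2} by rewrite polyX_eq0.
have a0 : a.[0] = 0.
  have := congr1 (horner^~ 0) E; rewrite /= !hornerE /= ?mul0r ?addr0 => /eqP.
  by rewrite expf_eq0 => /eqP.
have [a' Ea] := divX _ a0.
have E1 : 'X * a' ^+ 2 + (c ^+ 2 - c * d + d ^+ 2) = 0.
  by apply: (mulfI X0); rewrite mulr0 -[RHS]E Ea; ring.
have [c0 d0] : c.[0] = 0 /\ d.[0] = 0.
  have := congr1 (horner^~ 0) E1; rewrite /= !hornerE /= ?mul0r ?add0r.
  by case: (F2_cases c.[0]) => ->; case: (F2_cases d.[0]) => ->.
have [c' Ec] := divX _ c0; have [d' Ed] := divX _ d0.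
have E2 : a' ^+ 2 + 'X * (c' ^+ 2 - c' * d' + d' ^+ 2) = 0.
  by apply: (mulfI X0); rewrite mulr0 -[RHS]E1 Ec Ed; ring.
have szs (p : {poly 'F_2}) : size (p * 'X) = (if p == 0 then 0%N else (size p).+1).
  by have [->|p0] := eqVneq p 0; rewrite ?mul0r ?size_poly0 // size_mulX.
have [/and3P[/eqP h1 /eqP h2 /eqP h3]|nz] := boolP [&& a' == 0, c' == 0 & d' == 0].
  by rewrite Ea Ec Ed h1 h2 h3 !mul0r.
have [] := IH a' c' d' _ E2.
  move: sz nz; rewrite Ea Ec Ed !szs.
  by do 3!(case: eqP => [->|_]); rewrite ?size_poly0 //= => *; lia.
by rewrite Ea Ec Ed => -> -> ->; rewrite !mul0r.
Qed.

(* If the word w is scalar at z, then its entries b0, b1, and a1 are divisible by g, and the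
   norm equation forces a1 to be divisible by g^2 since 2 = 0. *)
Lemma word_length (F : finFieldType) (phi : {rmorphism {poly 'F_2} -> F}) (g : {poly 'F_2}) D c m :
  2%:R = 0 :> F -> phi 'X != 1 -> (D < size g)%N -> (forall f, (phi f == 0) = (g %| f)) ->
  path.sorted (fun a b : 'I_3 => a != b) c -> size c = m.*2 -> (0 < m)%N ->
  qword (phi 'X) c = qscal ((1 + phi 'X) ^+ m) -> (4 * D <= size c)%N.
Proof.
move=> two z1 Dg divE so szc m0 E.
have div f : phi f = 0 -> g %| f by move=> /eqP; rewrite divE.
have two2 : 2%:R = 0 :> {poly 'F_2} by rewrite -polyC_natr; congr (_%:P); apply: val_inj.
have u0 : (1 + phi 'X) ^+ m != 0.
  rewrite expf_eq0 m0 /=; apply: contra z1 => /eqP h.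
  have -> : phi 'X = (1 + phi 'X) - 2%:R + 1 by ring.
  by rewrite h two subr0 add0r.
have g0 : g != 0 by rewrite -size_poly_gt0; lia.
have nz : qmap (horner_eval (1 : 'F_2)) (qword 'X c) != (0, 0, 0, 0).
  rewrite qmap_word /= /horner_eval hornerX; case: (c) so szc => [|i c'] so szc; last exact: word_neq0.
  by move: szc m0; case: (m).
have := qmap_word phi 'X c; rewrite E.
have := size_word c; have := qnorm_word ('X : {poly 'F_2}) c; move: nz.
case: (qword 'X c) => [[[a0 a1] b0] b1] /= nz nE [_ sa1 _ _] [Ea Ea1 Eb0 Eb1].
have /div/dvdpP[a1' Ea1'] := Ea1; have /div/dvdpP[b0' Eb0'] := Eb0; have /div/dvdpP[b1' Eb1'] := Eb1.
have /div/dvdpP[a0' Ea0'] : phi (a0 - (1 + 'X) ^+ m) = 0.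
  by rewrite rmorphB Ea rmorphXn rmorphD rmorph1 subrr.
have {}Ea0' : a0 = (1 + 'X) ^+ m + a0' * g by rewrite -Ea0' addrC subrK.
(* In the norm equation the square of [(1 + 'X) ^+ m] cancels and the mixed term vanishes since 2 =
   0. What remains equates [a0 * a1' * g] with a multiple of [g ^+ 2]; one factor [g] is
   cancelled. *)
have key : g * (a0' ^+ 2 + a1' ^+ 2 + 'X * (b0' ^+ 2 - b0' * b1' + b1' ^+ 2)) = a0 * a1'.
  apply: (mulfI g0).
  have : a0 ^+ 2 - a0 * a1 + a1 ^+ 2 + 'X * (b0 ^+ 2 - b0 * b1 + b1 ^+ 2) = ((1 + 'X) ^+ m) ^+ 2.
    by rewrite nE szc -exprM muln2.
  rewrite {1}Ea0' Ea1' Eb0' Eb1'; move: ((1 + 'X) ^+ m) => u.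
  move=> H; have : u ^+ 2 - u ^+ 2 = 0 by rewrite subrr.
  rewrite -{1}H => {}H; apply/eqP; rewrite -subr_eq0; apply/eqP; rewrite -[RHS]H.
  transitivity (g * (g * (a0' ^+ 2 + a1' ^+ 2 + 'X * (b0' ^+ 2 - b0' * b1' + b1' ^+ 2))) - g * (a0 * a1') + 2%:R * (u * (a0' * g))).
    by rewrite two2 mul0r addr0.
  by ring.
have phia : phi a1' = 0.
  have := congr1 phi key; rewrite !rmorphM Ea.
  have /eqP -> : phi g == 0 by rewrite divE.
  by rewrite mul0r => /esym/eqP; rewrite mulf_eq0 (negPf u0) => /eqP.
have /div/dvdpP[a1'' Ea1''] := phia.
have [a1z|a1nz] := eqVneq a1 0; last first.
  have nz'' : a1'' != 0 by apply: contra a1nz => /eqP h; rewrite Ea1' Ea1'' h !mul0r.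
  have ar p q n : (D < p)%N -> (0 < q)%N -> (((q + p).-1 + p).-1 <= n.+1)%N -> (4 * D <= n.*2)%N.
    by clear; lia.
  rewrite szc; apply: (ar _ (size a1'') _ Dg); first by rewrite size_poly_gt0.
  by have := sa1; rewrite Ea1' Ea1'' size_mul ?mulf_neq0 // size_mul // szc doubleK.
(* If [a1] vanishes, so do the other quotients by anisotropy, and the word is [(1 + 'X) ^+ m], which
   is zero at 1, against [nz]. *)
exfalso.
have a1'0 : a1' = 0 by apply: (mulIf g0); rewrite -Ea1' a1z mul0r.
have [h1 h2 h3] : [/\ a0' = 0, b0' = 0 & b1' = 0].
  apply: poly_isotropic_free; apply: (mulfI g0); rewrite mulr0.
  by move: key; rewrite a1'0 expr0n addr0 mulr0.
move: nz; rewrite a1z Eb0' Eb1' h2 h3 !mul0r Ea0' h1 mul0r addr0.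
rewrite /horner_eval !hornerE.
have -> : 1 + 1 = 0 :> 'F_2 by apply: val_inj.
by rewrite expr0n eqn0Ngt m0 eqxx.
Qed.

End Words.

Section NormOne.
Variables (F : finFieldType) (z : F).

Definition norm_one : predArgType := {v : quat F | qnorm z v == 1}.

(** For fixed [a1], [b0], [b1] the norm equation is quadratic in [a0], with roots [r] and [a1 - r];
    one bit tells whether [a0] is the picked root. *)
Lemma card_norm_one : (#|{: norm_one}| <= 2 * #|F| ^ 3)%N.
Proof.
pose rt (t : F * F * F) : F :=
  odflt 0 [pick a0 | qnorm z (a0, t.1.1, t.1.2, t.2) == 1].
pose f (v : norm_one) : F * F * F * bool :=
  let: (a0, a1, b0, b1) := val v in (a1, b0, b1, a0 == rt (a1, b0, b1)).
have fi : injective f.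
  move=> [[[[a0 a1] b0] b1] /= p] [[[[a0' a1'] b0'] b1'] /= p'].
  rewrite /f /= => -[E1 E2 E3]; rewrite -E1 -E2 -E3 in p' * => E4; apply: val_inj => /=.
  congr (_, _, _, _); move: E4; rewrite /rt /=; case: pickP => [r pr|/(_ a0)]; last by rewrite p.
  rewrite /=; have [-> /esym/eqP -> //|ar] := eqVneq a0 r.
  have [-> //|ar' _] := eqVneq a0' r.
  have root b : b != r ->
      b ^+ 2 - b * a1 + a1 ^+ 2 + z * (b0 ^+ 2 - b0 * b1 + b1 ^+ 2) == 1 -> b = a1 - r.
    move=> br /eqP pb; move/eqP: pr => pr; apply/eqP; rewrite -subr_eq0.
    have : (b - r) * (b - (a1 - r)) = 0.
      transitivity ((b ^+ 2 - b * a1 + a1 ^+ 2 + z * (b0 ^+ 2 - b0 * b1 + b1 ^+ 2)) -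
         (r ^+ 2 - r * a1 + a1 ^+ 2 + z * (b0 ^+ 2 - b0 * b1 + b1 ^+ 2))); first by ring.
      by rewrite pb pr subrr.
    by move/eqP; rewrite mulf_eq0 !subr_eq0 (negPf br).
  by rewrite (root _ ar p) (root _ ar' p').
rewrite -(card_codom fi); apply: leq_trans (max_card _) _.
by rewrite !card_prod card_bool mulnC !expnS expn0 muln1 !mulnA.
Qed.

End NormOne.

(* A 3-edge-coloured bipartite cubic graph on two copies of [A]: the edge of colour [i] at the
   left vertex [a] leads to the right vertex [pi i a], and back since [pi i] is an involution. *)
Lemma coloured_cubic_graph D : (1 < D)%N ->
  exists (A : finType) (pi : 'I_3 -> A -> A),
    [/\ (0 < #|A|)%N, (#|A| <= 2 * 2 ^ (3 * D))%N, forall i, involutive (pi i) &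
        forall c a, path.sorted (fun i j : 'I_3 => i != j) c -> (0 < size c)%N ->
          ~~ odd (size c) -> foldl (fun v i => pi i v) a c = a -> (4 * D <= size c)%N].
Proof.
move=> D1; have [F [phi [g [two cF z1 Dg div]]]] := binary_field_evaluation D1.
pose z := phi 'X; rewrite -/z in z1.
(* Square roots exist because raising to the power [#|F|], an iterated squaring, is the identity. *)
have [s s2] : exists s, s ^+ 2 = 1 + z.
  exists ((1 + z) ^+ (2 ^ D.-1)); rewrite -exprM -expnSr prednK ?(ltnW D1) //.
  by rewrite -cF expf_card.
have z0 : 1 + z != 0.
  apply: contra z1 => /eqP h.
  have -> : z = (1 + z) - 2%:R + 1 by ring.
  by rewrite h two subr0 add0r.
have s0 : s != 0 by apply: contra z0 => /eqP h; rewrite -s2 h expr0n.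
(* A generator has norm [s ^+ 2], so dividing by [s] preserves norm one. *)
pose step i (v : quat F) := qmul z (qmul z (qscal s^-1) v) (qgen F i).
have normP i (v : norm_one z) : qnorm z (step i (val v)) == 1.
  rewrite /step !qnormM qnorm_scal qnorm_gen (eqP (valP v)) mulr1 -s2 -exprMn.
  by rewrite mulVf // expr1n.
pose pi i (v : norm_one z) : norm_one z := exist (fun v => qnorm z v == 1) _ (normP i v).
have stepE i v : step i v = qmul z (qscal s^-1) (qmul z v (qgen F i)).
  by rewrite /step qmulA.
have walkE c (v : norm_one z) : val (foldl (fun v i => pi i v) v c) =
    qmul z (qscal (s^-1 ^+ size c)) (qmul z (val v) (qword z c)).
  elim/last_ind: c => [|c i IH].
    by rewrite -[size [::]]/0%N expr0 -[qword z [::]]/(qscal 1) -qscalC !qscal1.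
  have -> : val (foldl (fun v i => pi i v) v (rcons c i)) = step i (val (foldl (fun v i => pi i v) v c)).
    by rewrite -cats1 foldl_cat.
  rewrite IH stepE qword_rcons size_rcons exprS -(qscalM z).
  by rewrite !qmulA.
have n0 : (0 < #|{: norm_one z}|)%N.
  have h : qnorm z (qscal 1) == 1 by rewrite qnorm_scal expr1n.
  by apply/card_gt0P; exists (exist (fun v => qnorm z v == 1) _ h).
exists (norm_one z), pi; split => //.
- by apply: leq_trans (card_norm_one z) _; rewrite cF -expnM [(D * 3)%N]mulnC.
- move=> i v; apply: val_inj; etransitivity; first exact: (walkE [:: i; i] v).
  have -> : qword z [:: i; i] = qscal (s ^+ 2).
    by rewrite -[qword z _]/(qmul z (qmul z (qscal 1) (qgen F i)) (qgen F i)) qscal1 qgen_sq // s2.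
  rewrite -[size [:: i; i]]/2%N.
  by rewrite -qscalC qmulA qscalM -exprMn mulVf // expr1n qscal1.
move=> c a so c0 ev clo.
have szc : size c = (size c)./2.*2 by rewrite -[LHS]odd_double_half (negPf ev).
apply: (word_length (m := (size c)./2) two z1 Dg div so szc).
  by rewrite half_gt0; move: c0 ev; case: (size c) => [|[|]].
have := walkE c a; rewrite clo => E.
(* Multiplication by the conjugate cancels [val a], which has norm one; the word is then the scalar
   [s ^+ size c], a power of [1 + z]. *)
have : qmul z (qscal (s ^+ size c)) (qmul z (qconj (val a)) (val a)) =
       qmul z (qconj (val a)) (qmul z (val a) (qword z c)).
  rewrite {2}E qscalC -qmulA; congr qmul.
  by rewrite -qscalC qmulA qscalM -exprMn divff // expr1n qscal1.
rewrite [in RHS]qmulA qmulVq (eqP (valP a)) qscal1 qscalM mulr1 => <-.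
by rewrite -s2 -exprM mul2n -szc.
Qed.

End CubicGraph.

(** * The two bounds *)

(** Take [s = 2 ^ b], so that [s * s = 4 ^ b] is at least [l]. The base 4 logarithm is what halves
    the iterated logarithm, giving [2 * log2 (log2 k)] after multiplication by 4. *)
Lemma gset_upper_bound k p g : 5 <= k -> 2 <= p -> gset k p g ->
  g <= (4 * (16 + up_log 4 (up_log 2 k) + up_log 2 k) + 2) * p.-1.
Proof.
move=> k5 p2 [T [e [sg free gth nd]]].
set l := up_log 2 k; set b := up_log 4 l.
apply: (girth_upper_bound (s := 2 ^ b) sg free gth nd p2) => //.
- exact: leq_trans k5.
- by rewrite expn_gt0.
- rewrite -expnD addnn -mul2n expnM.
  apply: leq_trans (up_logP k (isT : 1 < 2)) _.
  by rewrite leq_exp2l //; exact: (up_logP l (isT : 1 < 4)).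
- rewrite 2!expnD -mulnA leq_mul2l; apply/orP; right.
  by rewrite leq_mul2l; apply/orP; right; exact: (up_logP k (isT : 1 < 2)).
Qed.

(** With [D = 2 * j] there are at most [q ^ 2] cubic vertices for [q = 2 ^ (3 * j + 1)], fewer than
    [(q + 3) * q = k * (k - 3)]. *)
Lemma gset_lower_bound j p : 0 < j -> 2 <= p ->
  gset (2 ^ (3 * j + 1) + 3) p (8 * j * p.-1).
Proof.
move=> j0 p2; have D1 : 1 < 2 * j by rewrite mul2n -addnn; move: j0; clear; lia.
have [A [pi [A0 cA piK cw]]] := coloured_cubic_graph D1.
have -> : 8 * j = 4 * (2 * j) by rewrite mulnA.
apply: (gset_subdivision (A := A) (pi := pi)) => //.
  by move: j0; clear; lia.
apply: (@leq_ltn_trans (2 ^ (3 * j + 1) * 2 ^ (3 * j + 1))).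
  rewrite -expnD; apply: leq_trans (leq_mul (leqnn 2) cA) _.
  by rewrite -!expnS leq_exp2l //; clear; lia.
have : 0 < 2 ^ (3 * j + 1) by rewrite expn_gt0.
by rewrite addnK; move: (2 ^ _) => q; clear; nia.
Qed.

From mathcomp Require Import all_order all_algebra.
From mathcomp Require Import all_classical all_reals all_analysis.
From mathcomp Require Import lra.
Unset Implicit Arguments.
Import Order.TTheory GRing.Theory Num.Theory.
Local Open Scope ring_scope.
Local Open Scope classical_set_scope.

(** * Binary logarithms *)

Section Log2.
Variable R : realType.

Let ln2_gt0 : 0 < ln 2 :> R. Proof. by rewrite ln_gt0 // ltr1n. Qed.

Lemma log2_expn n : log2 ((2 ^ n)%N%:R : R) = n%:R.
Proof.
by rewrite /log2 natrX lnXn ?ltr0n // -[_ *+ n]mulr_natl mulfK // gt_eqF.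
Qed.

Lemma ler_log2 (x y : R) : 0 < x -> x <= y -> log2 x <= log2 y.
Proof.
move=> x0 xy; rewrite /log2 ler_pM2r ?invr_gt0 // ler_ln // posrE //.
exact: lt_le_trans xy.
Qed.

Lemma log2M (x y : R) : 0 < x -> 0 < y -> log2 (x * y) = log2 x + log2 y.
Proof. by move=> x0 y0; rewrite /log2 lnM ?posrE // mulrDl. Qed.

Lemma up_log2_le k : (1 < k)%N -> (up_log 2 k)%:R <= log2 (k%:R : R) + 1.
Proof.
move=> k1; have l0 : (0 < up_log 2 k)%N by rewrite up_log_gt0 k1.
have := up_log_bounds (isT : (1 < 2)%N) k1 => /andP[h _].
rewrite -(prednK l0) -natr1 lerD2r -[X in X <= _]log2_expn; apply: ler_log2.
  by rewrite ltr0n expn_gt0.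
by rewrite ler_nat ltnW.
Qed.

Lemma up_log4_le l : (1 < l)%N -> 2 * (up_log 4 l)%:R <= log2 (l%:R : R) + 2.
Proof.
move=> l1; have b0 : (0 < up_log 4 l)%N by rewrite up_log_gt0 l1.
have := up_log_bounds (isT : (1 < 4)%N) l1 => /andP[h _].
have : (2 * (up_log 4 l).-1)%:R <= log2 (l%:R : R).
  rewrite -[X in X <= _]log2_expn; apply: ler_log2; first by rewrite ltr0n expn_gt0.
  by rewrite ler_nat expnM ltnW.
by rewrite natrM -{2}(prednK b0) -natr1; lra.
Qed.

(** The constant is 66 from [4 * 16 + 2], plus 4 for each of the two roundings, plus 2 from bounding
    [up_log 2 k] by [2 * log2 k] inside the logarithm. *)
Lemma up_log_sum_le k : (5 <= k)%N ->
  (4 * (16 + up_log 4 (up_log 2 k) + up_log 2 k) + 2)%:R <=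
    4 * log2 (k%:R : R) + 2 * log2 (log2 (k%:R : R)) + 76.
Proof.
move=> k5; have k1 : (1 < k)%N by exact: leq_trans k5.
have l1 : (1 < up_log 2 k)%N.
  by rewrite -(ltn_exp2l (m := 2)) //; apply: leq_trans (up_logP k (isT : (1 < 2)%N)); exact: leq_trans k5.
have h1 := @up_log2_le k k1; have h2 := @up_log4_le (up_log 2 k) l1.
have L1 : 1 <= log2 (k%:R : R).
  rewrite -[X in X <= _](log2_expn 1); apply: ler_log2; first by rewrite ltr0n.
  by rewrite expn1 ler_nat.
have h3 : log2 ((up_log 2 k)%:R : R) <= 1 + log2 (log2 (k%:R : R)).
  apply: (@le_trans _ _ (log2 (2 * log2 (k%:R : R)))).
    by apply: ler_log2; [rewrite ltr0n ltnW | lra].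
  rewrite log2M ?ltr0n //; last by lra.
  by rewrite lerD2r -[X in _ <= X](log2_expn 1) expn1.
by rewrite !(natrD, natrM); lra.
Qed.

End Log2.

Lemma infinite_range_nat (f : nat -> nat) : injective f -> infinite_set (range f).
Proof.
move=> fi fin; apply: infinite_nat.
have -> : [set: nat] = f @^-1` (range f) by apply/seteqP; split => // x _; exists x.
by apply: finite_preimage fin => x y _ _; exact: fi.
Qed.

Theorem mainTheorem9 (R : realType) :
  (exists C : R, forall k p : nat, (5 <= k)%N -> (2 <= p)%N ->
     (gK R k p <
      ((4 * log2 (k%:R : R) + 2 * log2 (log2 (k%:R : R)) + C)
         * (p.-1)%:R)%:E)%E)
  /\
  (exists (c : R) (K : set nat), infinite_set K /\
     forall k p : nat, K k -> (2 <= p)%N ->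
       (((8 / 3) * log2 (k%:R : R) + c) * (p.-1)%:R)%:E <= gK R k p)%E.
Proof.
split.
  (* The supremum is bounded with 76; one more unit makes the inequality strict. *)
  exists 77 => k p k5 p2.
  have p0 : 0 < (p.-1)%:R :> R by rewrite ltr0n; case: p p2 => [|[]].
  pose M := (4 * log2 (k%:R : R) + 2 * log2 (log2 (k%:R : R)) + 76) * (p.-1)%:R.
  apply: (@le_lt_trans _ _ M%:E); last by rewrite lte_fin ltr_pM2r //; lra.
  apply: ub_ereal_sup => _ [g /(gset_upper_bound k5 p2) gk <-].
  rewrite lee_fin; apply: (@le_trans _ _ (((4 * (16 + up_log 4 (up_log 2 k) + up_log 2 k) + 2) * p.-1)%N%:R)).
    by rewrite ler_nat.
  by rewrite natrM ler_pM2r // up_log_sum_le.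
(* As [log2 k] is at most [3 * j.+1 + 2], the term [8 / 3 * log2 k] exceeds [8 * j.+1] by at most
   [16 / 3]. *)
exists (- (16 / 3)), (range (fun j => 2 ^ (3 * j.+1 + 1) + 3)%N); split.
  apply: infinite_range_nat => i j /eqP.
  by rewrite eqn_add2r eqn_exp2l // eqn_add2r eqn_pmul2l // => /eqP[].
move=> _ p [j _ <-] p2.
have gs := @gset_lower_bound j.+1 p isT p2.
apply: le_trans (ereal_sup_ubound _); last by exists (8 * j.+1 * p.-1)%N; [exact: gs|].
rewrite lee_fin natrM ler_wpM2r //.
have : log2 ((2 ^ (3 * j.+1 + 1) + 3)%N%:R : R) <= (3 * j.+1 + 2)%N%:R.
  rewrite -[X in _ <= X]log2_expn; apply: ler_log2; first by rewrite ltr0n addn_gt0 orbT.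
  rewrite ler_nat (addnS _ 1) expnS mul2n -addnn leq_add2l.
  by apply: (@leq_trans (2 ^ 2)%N) => //; rewrite leq_exp2l // mulnS addnAC.
by rewrite !(natrD, natrM); lra.
Qed.
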